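(* Let $(W,S)$ be a finitely generated Coxeter system with Cayley graph $\Lambda=\Lambda(W,S)$, and suppose $W$ acts geometrically on a proper CAT(0) space $X$. Let $x\in X$ be a point not fixed by any non-trivial element of $W$, and let $\Lambda_x$ be the copy of $\Lambda$ at $x$ in $X$, with $W$-equivariant map $P_x:\Lambda\to\Lambda_x$. Then any CAT(0) geodesic ray in $X$ is tracked by a Cayley graph geodesic in $\Lambda_x$; that is, for every geodesic ray $r:[0,\infty)\to X$ there are a constant $K$ and a geodesic edge path $\beta$ in $\Lambda$ such that every point of $r$ is within distance $K$ (in $X$) of a point of $P_x(\beta)$.
   Context: A Coxeter system $(W,S)$ is a group $W$ with generating set $S$ and presentation $\langle S : (s_is_j)^{m(i,j)}\rangle$, where $m(i,j)=m(j,i)\in\{1,2,\ldots,\infty\}$, $m(i,j)=1$ iff $i=j$, and the relation is omitted if $m(i,j)=\infty$; it is finitely generated if $S$ is finite. The Cayley graph $\Lambda(W,S)$ has vertex set $W$ and, for each $w\in W$, $s\in S$, a single edge of length 1 joining $w$ and $ws$; $d$ is the path metric. A geodesic edge path in $\Lambda$ is an edge path (finite, a ray on $[0,\infty)$, or a line on $(-\infty,\infty)$, each unit interval between consecutive integers being mapped isometrically onto an edge) satisfying $d(\beta(s),\beta(t))=|s-t|$ for all integers $s,t$ in its domain. A group acts geometrically on a space if the action is properly discontinuous, cocompact and by isometries. CAT(0) spaces are taken to be proper complete geodesic metric spaces satisfying the CAT(0) inequality. Given a geometric action of $W$ on a CAT(0) space $X$ and $x\in X$, $\Lambda_x\subset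 X$ is the graph with vertex set the orbit $Wx$ and with a CAT(0) geodesic edge connecting $w_1x$ and $w_2x$ ($w_1,w_2\in W$) whenever $w_1s=w_2$ for some $s\in S$. $P_x:\Lambda\to\Lambda_x$ is the $W$-equivariant map with $P_x(w)=wx$ on vertices which maps each edge of $\Lambda$ onto the corresponding CAT(0) geodesic edge. *)

(* Defs.v *)
From mathcomp Require Import all_boot all_order all_algebra.
From mathcomp Require Import all_classical all_reals all_analysis.

Set Implicit Arguments.
Unset Strict Implicit.
Unset Printing Implicit Defensive.

Import Order.TTheory GRing.Theory Num.Theory.

Local Open Scope classical_set_scope.
Local Open Scope ring_scope.

(** * Group presentations and Coxeter systems *)

(** A letter [(i, false)] stands for the generator [i] and [(i, true)] for its
    formal inverse. *)
Definition word (I : Type) := seq (I * bool).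

(** Two words are identified when they agree in the quotient of the free group
    on [I] by the normal closure of [rel]. *)
Inductive presented_eq (I : Type) (rel : set (word I)) : word I -> word I -> Prop :=
| presented_refl u : presented_eq rel u u
| presented_sym u v : presented_eq rel u v -> presented_eq rel v u
| presented_trans u v w :
    presented_eq rel u v -> presented_eq rel v w -> presented_eq rel u w
| presented_cat u u' v v' :
    presented_eq rel u u' -> presented_eq rel v v' ->
    presented_eq rel (u ++ v) (u' ++ v')
| presented_cancel i b : presented_eq rel [:: (i, b); (i, ~~ b)] [::]
| presented_relator r : rel r -> presented_eq rel r [::].

Definition word_val (W : groupType) (I : Type) (s : I -> W) (u : word I) : W :=
  foldr (fun a g => ((if a.2 then (s a.1)^-1 else s a.1) * g)%g) 1%g u.

Definition has_presentation (W : groupType) (I : Type) (s : I -> W)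
    (rel : set (word I)) : Prop :=
  (forall w : W, exists u, word_val s u = w) /\
  (forall u v, word_val s u = word_val s v <-> presented_eq rel u v).

(** [None] encodes the value infinity. *)
Definition coxeter_matrix (I : Type) (m : I -> I -> option nat) : Prop :=
  [/\ forall i j, m i j = m j i,
      forall i j, m i j = Some 1%N <-> i = j
    & forall i j, m i j <> Some 0%N].

Definition coxeter_relators (I : Type) (m : I -> I -> option nat) : set (word I) :=
  [set r | exists i j n, m i j = Some n /\
             r = flatten (nseq n [:: (i, false); (j, false)])].

(** The generating set S is the family [s] of distinct elements [s i]. *)
Definition coxeter_system (W : groupType) (I : Type) (s : I -> W)
    (m : I -> I -> option nat) : Prop :=
  [/\ injective s, coxeter_matrix m & has_presentation s (coxeter_relators m)].

(** * The Cayley graph *)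

Definition cayley_adj (W : groupType) (I : Type) (s : I -> W) (v w : W) : Prop :=
  exists i, w = (v * s i)%g.

Definition cayley_walk (W : groupType) (I : Type) (s : I -> W) (v w : W) (n : nat) : Prop :=
  exists p : nat -> W,
    [/\ p 0%N = v, p n = w & forall k, (k < n)%N -> cayley_adj s (p k) (p k.+1)].

(** The path metric on vertices: the infimum of the lengths of edge paths. *)
Definition cayley_dist (R : realType) (W : groupType) (I : Type) (s : I -> W)
    (v w : W) : R :=
  inf [set n%:R | n in cayley_walk s v w].

Inductive path_domain := FinitePath of nat | RayPath | LinePath.

Definition in_domain (D : path_domain) (k : int) : Prop :=
  match D with
  | FinitePath n => (0 <= k <= n%:Z)
  | RayPath => 0 <= k
  | LinePath => True
  end.

(** Distinct vertices are joined by at most one edge, so an edge path is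
    determined by its vertices [b k], for [k] an integer of the domain; the
    values of [b] outside the domain are irrelevant. *)
Definition edge_path (W : groupType) (I : Type) (s : I -> W) (D : path_domain)
    (b : int -> W) : Prop :=
  forall k, in_domain D k -> in_domain D (k + 1) -> cayley_adj s (b k) (b (k + 1)).

Definition geodesic_edge_path (R : realType) (W : groupType) (I : Type) (s : I -> W)
    (D : path_domain) (b : int -> W) : Prop :=
  edge_path s D b /\
  forall k l, in_domain D k -> in_domain D l ->
    cayley_dist R s (b k) (b l) = `|(k - l)%:~R|.

(** * CAT(0) spaces *)

Section CAT0.
Context {R : realType} {X : metricType R}.

(** A geodesic from [p] to [q], parametrized by arc length on [[0, d(p, q)]]. *)
Definition geodesic_between (c : R -> X) (p q : X) : Prop :=
  [/\ c 0 = p, c (mdist p q) = q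
    & forall t u, 0 <= t <= mdist p q -> 0 <= u <= mdist p q ->
        mdist (c t) (c u) = `|t - u|].

Definition geodesic_ray (c : R -> X) : Prop :=
  forall t u, 0 <= t -> 0 <= u -> mdist (c t) (c u) = `|t - u|.

Definition geodesic_edge (p q : X) : set X :=
  [set z | exists c, geodesic_between c p q /\
             exists2 t, 0 <= t <= mdist p q & z = c t].

(** Matrices carry the sup norm in the library. *)
Definition euclid_dist (a b : 'rV[R]_2) : R :=
  Num.sqrt (\sum_(i < 2) (a 0 i - b 0 i) ^+ 2).

(** The sides through [p] of a geodesic triangle [p q r] are compared with those
    of a comparison triangle [p' q' r'].  As the vertices can be permuted and
    geodesics reversed, this covers any two sides of the triangle; for two points
    on one side the inequality is an equality. *)
Definition cat0_inequality : Prop :=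
  forall (p q r : X) (c1 c2 c3 : R -> X) (p' q' r' : 'rV[R]_2),
    geodesic_between c1 p q -> geodesic_between c2 p r -> geodesic_between c3 q r ->
    euclid_dist p' q' = mdist p q -> euclid_dist p' r' = mdist p r ->
    euclid_dist q' r' = mdist q r ->
    forall t u, 0 <= t <= 1 -> 0 <= u <= 1 ->
      mdist (c1 (t * mdist p q)) (c2 (u * mdist p r)) <=
      euclid_dist ((1 - t) *: p' + t *: q') ((1 - u) *: p' + u *: r').

Definition geodesic_space : Prop :=
  forall p q : X, exists c, geodesic_between c p q.

Definition proper_space : Prop :=
  forall (p : X) (e : R), compact [set q | mdist p q <= e].

Definition complete_space : Prop :=
  forall F : set_system X, ProperFilter F -> cauchy F -> exists l : X, F --> l.

End CAT0.

Definition cat0_space (R : realType) (X : metricType R) : Prop :=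
  [/\ @proper_space R X, @complete_space R X, @geodesic_space R X
    & @cat0_inequality R X].

(** * Geometric actions *)

Section Action.
Context {R : realType} {W : groupType} {X : metricType R}.
Implicit Type act : W -> X -> X.

Definition group_action act : Prop :=
  (forall x, act 1%g x = x) /\
  (forall g h x, act (g * h)%g x = act g (act h x)).

Definition isometric_action act : Prop :=
  forall g x y, mdist (act g x) (act g y) = mdist x y.

Definition properly_discontinuous act : Prop :=
  forall A : set X, compact A -> finite_set [set g | (act g @` A) `&` A !=set0].

Definition cocompact act : Prop :=
  exists2 A : set X, compact A & \bigcup_(g in setT) (act g @` A) = setT.

Definition geometric_action act : Prop :=
  [/\ group_action act, properly_discontinuous act, cocompact act
    & isometric_action act].

(** The image under [P_x] of the edge path with vertices [b k]: the points
    [b k x], and the CAT(0) geodesic edges joining consecutive ones. *)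
Definition Px_image act (x : X) (D : path_domain) (b : int -> W) : set X :=
  [set z | (exists2 k, in_domain D k & z = act (b k) x) \/
           (exists k, [/\ in_domain D k, in_domain D (k + 1)
                        & geodesic_edge (act (b k) x) (act (b (k + 1)) x) z])].

End Action.

(* Main.v *)
(* Follow the ray [r] by orbit points [a k x]. A half-space of the Cayley graph that
   separates [a k] from an earlier and from a later [a l] is bounded by a reflection
   with bounded displacement near two points of [r] on either side of [r k]; the
   displacement is convex along [r], so it is bounded at [r k], and by properness the
   wall passes at bounded distance from [a k] in the Cayley graph.

   Fix [n]. Folding [a k] along the half-spaces that separate it from both [1] and
   [a n] gives [u k], at bounded distance from [a k], on a geodesic from [1] to [a n].
   In the weak order all [u k] lie below [a n], so [y k], the join of the [u j] with
   [j <= k], exists, and [y 0 <= y 1 <= ...] lie on a geodesic from [1]. A wall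
   separating [u k] from [y k] may come from half-spaces far from [u k], but by
   Radon's theorem in the Tits cone at most [#|I| + 1] half-spaces force it, and this
   bounds its distance from [u k]; hence [y k] is at bounded distance from [u k]. An
   ultralimit over [n] of these chains, with the gaps filled by reduced words, is a
   geodesic tracking [r]. *)
Require Import Defs.
From mathcomp Require Import all_boot all_order all_algebra.
From mathcomp Require Import all_classical all_reals all_analysis.
From mathcomp Require Import ring lra zify.

Set Implicit Arguments.
Unset Strict Implicit.
Unset Printing Implicit Defensive.

Import Order.TTheory GRing.Theory Num.Theory.

Local Open Scope classical_set_scope.
Local Open Scope ring_scope.

(** * The geometric representation *)

Section Chebyshev.
Context {R : realType}.

(** Chebyshev polynomials of the second kind: at [2 * cos x] the value is [sin (k x) / sin x] when
    [sin x] is nonzero. The argument [2] serves infinite orders. *)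
Fixpoint cheb (c : R) (k : nat) : R :=
  if k is k1.+1 then if k1 is k2.+1 then c * cheb c k1 - cheb c k2 else 1 else 0.

Lemma chebSS c k : cheb c k.+2 = c * cheb c k.+1 - cheb c k.
Proof. by []. Qed.

Lemma cheb2 k : cheb 2 k = k%:R.
Proof.
suff: cheb 2 k = k%:R /\ cheb 2 k.+1 = k.+1%:R by case.
elim: k => [|k [IH0 IH1]]; first by [].
by split=> //; rewrite chebSS IH1 IH0 -!natr1; ring.
Qed.

Lemma cheb_sin (x : R) k : sin x * cheb (2 * cos x) k = sin (k%:R * x).
Proof.
suff: sin x * cheb (2 * cos x) k = sin (k%:R * x) /\
      sin x * cheb (2 * cos x) k.+1 = sin (k.+1%:R * x) by case.
elim: k => [|k [IH0 IH1]]; first by rewrite /= mul0r sin0 mulr0 mulr1 mul1r.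
split=> //; rewrite chebSS mulrBr mulrCA IH0 IH1.
have -> : k%:R * x = k.+1%:R * x - x by rewrite -natr1; ring.
have -> : k.+2%:R * x = k.+1%:R * x + x by rewrite -[in LHS]natr1; ring.
by rewrite sinB sinD; ring.
Qed.

Section Angle.
Context (n : nat) (n2 : (1 < n)%N).
Let c : R := 2 * cos (pi / n%:R).

Let ngt0 : 0 < n%:R :> R. Proof. by rewrite ltr0n; lia. Qed.

Let angle k : (k <= n)%N -> 0 <= k%:R * (@pi R / n%:R) <= pi.
Proof.
move=> kn; rewrite mulr_ge0 ?divr_ge0 ?pi_ge0 ?ler0n //= mulrCA ger_pMr ?pi_gt0 //.
by rewrite ler_pdivrMr // mul1r ler_nat.
Qed.

Let angle_lt k : (0 < k < n)%N -> 0 < k%:R * (@pi R / n%:R) < pi.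
Proof.
move=> /andP[k0 kn]; rewrite mulr_gt0 ?divr_gt0 ?pi_gt0 ?ngt0 ?ltr0n //= mulrCA.
by rewrite gtr_pMr ?pi_gt0 // ltr_pdivrMr // mul1r ltr_nat.
Qed.

Let sin_angle : 0 < sin (pi / n%:R : R).
Proof. by rewrite -[pi / _]mul1r sin_gt0_pi // (@angle_lt 1) // n2. Qed.

Let chebE k : cheb c k = sin (k%:R * (pi / n%:R)) / sin (pi / n%:R).
Proof. by rewrite -cheb_sin mulrAC mulfV ?mul1r // gt_eqF. Qed.

Lemma cheb_ge0 k : (k <= n)%N -> 0 <= cheb c k.
Proof. by move=> kn; rewrite chebE; apply: divr_ge0; [exact/sin_ge0_pi/angle | exact: ltW]. Qed.

Lemma cheb_gt0 k : (0 < k < n)%N -> 0 < cheb c k.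
Proof.
by move=> kn; rewrite chebE; apply: divr_gt0; [exact/sin_gt0_pi/angle_lt | exact: sin_angle].
Qed.

Lemma cheb_period : cheb c (2 * n) = 0 /\ cheb c (2 * n).+1 = 1.
Proof.
have E : (2 * n)%:R * (pi / n%:R) = pi + pi :> R.
  by rewrite natrM -mulrA [n%:R * _]mulrCA mulfV ?gt_eqF // mulr1 mulrDl mul1r.
have s0 : sin (pi + pi) = 0 :> R by rewrite sinD sinpi mul0r mulr0 addr0.
have c1 : cos (pi + pi) = 1 :> R by rewrite cosD sinpi cospi mulrNN mul0r subr0 mulr1.
split; rewrite chebE; first by rewrite E s0 mul0r.
rewrite -natr1 mulrDl mul1r E sinD s0 c1 mul0r add0r mul1r mulfV //.
by rewrite gt_eqF.
Qed.

Lemma cheb_sqr_lt4 : c ^+ 2 < 4.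
Proof.
have := cos2Dsin2 (pi / n%:R : R); have := sin_angle.
rewrite /c; move: (cos _) (sin _) => x y; nra.
Qed.

End Angle.
End Chebyshev.

(** * Simple reflections, words and braid relations *)

Section Representation.
Context {R : realType} {W : groupType} {I : finType} (s : I -> W)
  (m : I -> I -> option nat).

(* The contragredient of the geometric representation: a function [f : I -> R] lists
   the values of a linear form on the simple roots, and [fire i] reflects it. *)
Definition cartan (i k : I) : R :=
  if i == k then - 2 else if m i k is Some n then 2 * cos (pi / n%:R) else 2.

Definition fire (i : I) (f : I -> R) : I -> R := fun k => f k + cartan i k * f i.

Definition fires (l : seq I) (f : I -> R) : I -> R := foldr fire f l.

Definition wprod (l : seq I) : W := foldr (fun i g => (s i * g)%g) 1%g l.

Definition word_of (w : W) : seq I := xget [::] [set l | wprod l = w].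

(** The action goes through a chosen word; [fires_wprod] shows that the choice does not matter. *)
Definition rep (w : W) : (I -> R) -> (I -> R) := fires (word_of w).

Fixpoint altw (j i : I) (k : nat) : seq I :=
  if k is k'.+1 then j :: altw i j k' else [::].

Lemma cartan_id i : cartan i i = - 2.
Proof. by rewrite /cartan eqxx. Qed.

Lemma fire_id i f : fire i f i = - f i.
Proof. by rewrite /fire cartan_id; ring. Qed.

Lemma fireK i : involutive (fire i).
Proof. by move=> f; apply/funext => k; rewrite {1}/fire fire_id /fire; ring. Qed.

Lemma fires_cat l1 l2 f : fires (l1 ++ l2) f = fires l1 (fires l2 f).
Proof. by rewrite /fires foldr_cat. Qed.

Lemma wprod_cat l1 l2 : wprod (l1 ++ l2) = (wprod l1 * wprod l2)%g.
Proof. by elim: l1 => [|i l IH] /=; rewrite ?mul1g // IH mulgA. Qed.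

Lemma fires_comb l a b f g k :
  fires l (fun i => a * f i + b * g i) k = a * fires l f k + b * fires l g k.
Proof. by elim: l k => //= i l IH k; rewrite /fire !IH; ring. Qed.

Lemma size_altw j i k : size (altw j i k) = k.
Proof. by elim: k i j => //= k IH i j; rewrite IH. Qed.

Lemma altw_rcons j i k : altw j i k.+1 = rcons (altw j i k) (if odd k then i else j).
Proof.
elim: k i j => // k IH i j.
by rewrite -[LHS]/(j :: altw i j k.+1) IH /=; case: (odd k).
Qed.

Lemma altwD j i a b :
  altw j i (a + b) = altw j i a ++ (if odd a then altw i j b else altw j i b).
Proof.
by elim: a i j => // a IH i j; rewrite addSn /= IH; case: (odd a).
Qed.

Lemma rev_altw j i k : rev (altw j i k) = if odd k then altw j i k else altw i j k.
Proof.
elim: k i j => // k IH i j; rewrite [in LHS]altw_rcons rev_rcons IH /=.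
by case: (odd k).
Qed.

Lemma altw2 j i n : flatten (nseq n [:: j; i]) = altw j i (2 * n).
Proof. by elim: n => // n IH; rewrite mulnS /= IH. Qed.

Section Cox.
Context (cox : coxeter_system s m).

Lemma cartan_sym i k : cartan i k = cartan k i.
Proof. by rewrite /cartan eq_sym; have [_ [-> _ _] _] := cox. Qed.

Lemma order_ge2 i j n : i != j -> m i j = Some n -> (1 < n)%N.
Proof.
have [_ [_ m1 m0] _] := cox.
case: n => [|[|n]] //; first by move=> _ /m0.
by move=> /eqP ij /m1.
Qed.

Lemma gen_sqr i : (s i * s i)%g = 1%g.
Proof.
have [_ [_ m1 _] [_ pres]] := cox.
suff: word_val s [:: (i, false); (i, false)] = word_val s [::] by rewrite /= mulg1.
apply/pres/presented_relator; exists i, i, 1%N.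
by split=> //; apply/m1.
Qed.

Lemma genV i : ((s i)^-1)%g = s i.
Proof. by apply: (mulgI (s i)); rewrite mulgV gen_sqr. Qed.

Lemma genKl i (w : W) : (s i * (s i * w))%g = w.
Proof. by rewrite mulgA gen_sqr mul1g. Qed.

Lemma genKr i (w : W) : (w * s i * s i)%g = w.
Proof. by rewrite -mulgA gen_sqr mulg1. Qed.

Lemma word_val_wprod u : word_val s u = wprod (map fst u).
Proof. by elim: u => //= -[i b] u ->; case: b; rewrite /= ?genV. Qed.

Lemma word_ofK w : wprod (word_of w) = w.
Proof.
have [_ _ [gen _]] := cox.
rewrite /word_of; case: xgetP => [x _ //|]; have [u <-] := gen w.
by move=> /(_ (map fst u)); rewrite /= word_val_wprod.
Qed.

Lemma wprod_rev l : wprod (rev l) = ((wprod l)^-1)%g.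
Proof.
elim: l => [|i l IH]; first by rewrite invg1.
by rewrite rev_cons -cats1 wprod_cat IH /= mulg1 invgM genV.
Qed.

(** The second half of the relator of length [2 * n] is the reverse of [altw i j n], hence its
    inverse in the group. *)
Lemma wprod_altw j i n : m j i = Some n -> wprod (altw j i n) = wprod (altw i j n).
Proof.
have [_ _ [_ pres]] := cox => mji.
have : wprod (altw j i (2 * n)) = 1%g.
  rewrite -altw2.
  have /pres : presented_eq (coxeter_relators m)
      (flatten (nseq n [:: (j, false); (i, false)])) [::].
    by apply: presented_relator; exists j, i, n.
  rewrite word_val_wprod map_flatten map_nseq /=; exact.
rewrite mul2n -addnn altwD wprod_cat.
have -> : (if odd n then altw i j n else altw j i n) = rev (altw i j n).
  by rewrite rev_altw.
by rewrite wprod_rev => /(congr1 (fun w => w * wprod (altw i j n)))%g; rewrite mulgVK mul1g.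
Qed.

Lemma fires_altw j i k f (c := cartan i j)
    (e := if odd k then j else i) (e' := if odd k then i else j) : i != j ->
  fires (altw j i k) f i = f e * cheb c k.+1 + f e' * cheb c k /\
  fires (altw j i k) f j = - (f e * cheb c k + f e' * (c * cheb c k - cheb c k.+1)).
Proof.
rewrite {}/c {}/e {}/e'.
elim: k j i => [|k IH] j i ij; first by rewrite /=; split; ring.
have ji : j != i by rewrite eq_sym.
have -> : fires (altw j i k.+1) f = fire j (fires (altw i j k) f) by [].
rewrite fire_id.
have [IHj IHi] := IH i j ji.
rewrite /fire IHj IHi (cartan_sym j i) /=; case: (odd k) => /=.
  by split; ring.
by split; ring.
Qed.

Lemma fires_altw_span j i k f :
  exists a b, forall p, fires (altw j i k) f p = f p + a * cartan i p + b * cartan j p.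
Proof.
elim: k j i => [|k IH] j i; first by exists 0, 0 => p; rewrite /= !mul0r !addr0.
have [a [b E]] := IH i j.
exists b, (a + fires (altw i j k) f j) => p.
have -> : fires (altw j i k.+1) f = fire j (fires (altw i j k) f) by [].
by rewrite {1}/fire E; ring.
Qed.

(** For [i != j], the relator adds a combination of the rows [i] and [j] of [cartan], which vanishes
    at [i] and [j] by [cheb_period]. The determinant [4 - c ^+ 2] is nonzero, so the combination is
    trivial. *)
Lemma fires_relator r : coxeter_relators m r -> fires (map fst r) =1 id.
Proof.
move=> [j [i [n [mji ->]]]] f; rewrite map_flatten map_nseq altw2.
case: (eqVneq i j) => [ij|ij].
  move: mji; rewrite ij => _; elim: n => // n IH.
  by rewrite mulnS -[altw _ _ _]/[:: j, j & altw j j (2 * n)] /= fireK.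
have ji : j != i by rewrite eq_sym.
have n2 := order_ge2 ji mji.
have cE : cartan i j = 2 * cos (pi / n%:R).
  by rewrite cartan_sym /cartan (negbTE ji) mji.
have [P0 P1] := @cheb_period R n n2.
have [Ei Ej] := @fires_altw j i (2 * n) f ij.
have [a [b E]] := fires_altw_span j i (2 * n) f.
apply/funext => p.
move: Ei Ej; rewrite cE P0 P1 mul2n odd_double -mul2n !E !cartan_id (cartan_sym j i) cE.
have := @cheb_sqr_lt4 R n n2; set c := 2 * _ => c4 Ei Ej.
have E1 : - 2 * a + b * c = 0 by lra.
have E2 : c * a - 2 * b = 0 by lra.
have /eqP : (4 - c ^+ 2) * a = 0.
  have -> : (4 - c ^+ 2) * a = - 2 * (- 2 * a + b * c) - c * (c * a - 2 * b) by ring.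
  by rewrite E1 E2 !mulr0 subr0.
rewrite mulf_eq0 subr_eq0 gt_eqF //= => /eqP a0.
have b0 : b = 0 by move: E2; rewrite a0 mulr0; lra.
by rewrite a0 b0 !mul0r !addr0.
Qed.

Lemma fires_presented u v : presented_eq (coxeter_relators m) u v ->
  fires (map fst u) =1 fires (map fst v).
Proof.
elim=> {u v} [//|u v _ IH f|u v w _ IH1 _ IH2 f|u u' v v' _ IH1 _ IH2 f|i b f|r rr f].
- by rewrite IH.
- by rewrite IH1 IH2.
- by rewrite !map_cat !fires_cat IH2 IH1.
- by rewrite /= fireK.
- by rewrite fires_relator.
Qed.

Lemma fires_wprod l1 l2 : wprod l1 = wprod l2 -> fires l1 =1 fires l2.
Proof.
have E (l : seq I) : l = map fst (map (fun i => (i, false)) l).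
  by rewrite -map_comp map_id.
have [_ _ [_ pres]] := cox.
by rewrite [l1]E [l2]E -!word_val_wprod => /pres /fires_presented.
Qed.

Lemma repE l f : rep (wprod l) f = fires l f.
Proof. by apply: fires_wprod; rewrite word_ofK. Qed.

Lemma rep1 f : rep 1%g f = f.
Proof. exact: (repE [::]). Qed.

Lemma repM u v f : rep (u * v)%g f = rep u (rep v f).
Proof. by rewrite -{1}(word_ofK u) -{1}(word_ofK v) -wprod_cat repE fires_cat. Qed.

Lemma rep_gen i f : rep (s i) f = fire i f.
Proof. by rewrite -[s i]mulg1; exact: (repE [:: i]). Qed.

Lemma rep_comb w a b f g k :
  rep w (fun i => a * f i + b * g i) k = a * rep w f k + b * rep w g k.
Proof. exact: fires_comb. Qed.

End Cox.
End Representation.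

(** * Word length and signs of coordinates *)

Section Length.
Context {W : groupType} {I : finType} (s : I -> W).
Local Notation wprod := (wprod s).

Definition len (w : W) : nat :=
  xget 0%N [set n | (exists2 l, wprod l = w & size l = n) /\
                    forall l, wprod l = w -> (n <= size l)%N].

Context {R : realType} (m : I -> I -> option nat) (cox : coxeter_system s m).

Lemma len_spec w : (exists2 l, wprod l = w & size l = len w) /\
  forall l, wprod l = w -> (len w <= size l)%N.
Proof.
rewrite /len; case: xgetP => [n _ //|none]; exfalso.
pose P n := `[< exists2 l, wprod l = w & size l = n >].
have exP : exists n, P n.
  by exists (size (word_of s w)); apply/asboolP; exists (word_of s w) => //; exact: (word_ofK cox).
case: (ex_minnP exP) => n /asboolP Pn minn; apply: (none n); split=> // l lw.
by apply: minn; apply/asboolP; exists l.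
Qed.

Lemma len_word w : exists2 l, wprod l = w & size l = len w.
Proof. by have [] := len_spec w. Qed.

Lemma len_wprod l : (len (wprod l) <= size l)%N.
Proof. by have [_] := len_spec (wprod l); apply. Qed.

Lemma len1 : len 1%g = 0%N.
Proof. by apply/eqP; rewrite -leqn0; exact: (len_wprod [::]). Qed.

Lemma len0 w : len w = 0%N -> w = 1%g.
Proof. by have [l <- <-] := len_word w => /size0nil ->. Qed.

Lemma lenM u v : (len (u * v)%g <= len u + len v)%N.
Proof.
have [l <- <-] := len_word u; have [l' <- <-] := len_word v.
by rewrite -wprod_cat -size_cat len_wprod.
Qed.

Lemma lenV w : len (w^-1)%g = len w.
Proof.
suff le u : (len (u^-1)%g <= len u)%N.
  by apply/eqP; rewrite eqn_leq le /= -{1}[w]invgK le.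
by have [l <- <-] := len_word u; rewrite -(wprod_rev cox) -(size_rev l) len_wprod.
Qed.

Lemma len_gen i : (len (s i) <= 1)%N.
Proof. by rewrite -[s i]mulg1; exact: (len_wprod [:: i]). Qed.

Lemma len_genl i w : (len (s i * w)%g <= (len w).+1)%N.
Proof. by apply: leq_trans (lenM _ _) _; rewrite -add1n leq_add2r len_gen. Qed.

Lemma len_genlV i w : (len w <= (len (s i * w)%g).+1)%N.
Proof. by rewrite -{1}[w](genKl cox i) len_genl. Qed.

Lemma len_descent w : w <> 1%g -> exists i, (len (s i * w)%g < len w)%N.
Proof.
have [[|i l] <- lw] := len_word w => // _; exists i.
by rewrite /= (genKl cox) -lw /= ltnS len_wprod.
Qed.

Local Notation cartan := (@cartan R I m).
Local Notation rep := (@rep R W I s m).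

Lemma cheb_cartan_ge0 i j k : i != j -> (forall n, m i j = Some n -> (k <= n)%N) ->
  0 <= cheb (cartan i j) k.
Proof.
move=> ij kn; rewrite /cartan (negbTE ij); case mij: (m i j) => [n|].
  by apply: cheb_ge0; [exact: (order_ge2 cox ij mij) | exact: kn].
by rewrite cheb2 ler0n.
Qed.

Lemma cheb_cartan_gt0 i j k : i != j -> (0 < k)%N ->
  (forall n, m i j = Some n -> (k < n)%N) -> 0 < cheb (cartan i j) k.
Proof.
move=> ij k0 kn; rewrite /cartan (negbTE ij); case mij: (m i j) => [n|].
  by apply: cheb_gt0; [exact: (order_ge2 cox ij mij) | rewrite k0; exact: kn].
by rewrite cheb2 ltr0n.
Qed.

(* Split off from the left of [w] a maximal alternating word in [j], [i]: the rest
   has neither [i] nor [j] as a left descent, and on the two coordinates [i], [j]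
   the alternating word acts with nonnegative Chebyshev coefficients. *)
Lemma rep_ge0 w i f : (len w <= len (s i * w)%g)%N -> (forall k, 0 <= f k) ->
  0 <= rep w f i.
Proof.
have [n] := ubnP (len w); elim: n w i => // n IH w i /ltnSE wn wi f0.
have [->|/eqP w1] := eqVneq w 1%g; first by rewrite (rep1 cox).
have [j jw] := len_descent w1.
have ij : i != j by apply: contraTneq jw => <-; rewrite -leqNgt.
pose P k := `[< exists2 w', w = (wprod (altw j i k) * w')%g & (k + len w')%N = len w >].
have P1 : P 1%N.
  apply/asboolP; exists (s j * w)%g; first by rewrite /= mulg1 (genKl cox).
  by have := len_genlV j w; lia.
have Pmax k : P k -> (k <= len w)%N by move=> /asboolP[w' _ <-]; exact: leq_addr.
case: (ex_maxnP (ex_intro (fun k => P k) _ P1) Pmax) => k /asboolP[w' wE kE] kmax.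
have k1 := kmax _ P1.
set e := if odd k then i else j; set e' := if odd k then j else i.
have ew' : (len w' <= len (s e * w')%g)%N.
  rewrite leqNgt; apply/negP => lt.
  have : P k.+1.
    apply/asboolP; exists (s e * w')%g.
      by rewrite altw_rcons -cats1 wprod_cat /= mulg1 -mulgA (genKl cox).
    by have := len_genlV e w'; lia.
  by move=> /kmax; rewrite ltnn.
(* [e'] is the last letter of the alternating word; as a left descent of [w'] it would cancel and
   give [w] too short an expression. *)
have e'w' : (len w' <= len (s e' * w')%g)%N.
  rewrite leqNgt; apply/negP => lt.
  have := lenM (wprod (altw j i k.-1)) (s e' * w')%g.
  have -> : (wprod (altw j i k.-1) * (s e' * w'))%g = w.
    have -> : w = (wprod (rcons (altw j i k.-1) e') * w')%g.
      rewrite wE /e'; move: k1; case: (k) => // k2 _.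
      by rewrite altw_rcons /=; case: (odd k2).
    by rewrite -cats1 wprod_cat /= mulg1 !mulgA.
  by have := len_wprod (altw j i k.-1); rewrite size_altw; lia.
(* If [N <= k], the braid relation makes the alternating word start with [i], so [s i * w] is
   shorter than [w], against the hypothesis. *)
have kn N : m i j = Some N -> (k < N)%N.
  move=> mij; rewrite ltnNge; apply/negP => Nk.
  have N2 := order_ge2 cox ij mij.
  have N1 : (0 < N)%N by lia.
  have mji : m j i = Some N by have [_ [-> _ _] _] := cox.
  have E : (s i * w)%g =
      (wprod (altw j i N.-1 ++ (if odd N then altw i j (k - N) else altw j i (k - N))) * w')%g.
    rewrite wE -(subnKC Nk) altwD !wprod_cat (wprod_altw cox mji) addKn -{1}(prednK N1) /=.
    by rewrite !mulgA (gen_sqr cox) mul1g.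
  have := lenM (wprod (altw j i N.-1 ++ (if odd N then altw i j (k - N) else altw j i (k - N)))) w'.
  have := len_wprod (altw j i N.-1 ++ (if odd N then altw i j (k - N) else altw j i (k - N))).
  by rewrite -E size_cat (fun_if size) !size_altw; case: (odd N); lia.
have pos_w' l : l \in [:: i; j] -> 0 <= rep w' f l.
  rewrite !inE => ll; apply: IH => //; first lia.
  by move: ew' e'w'; rewrite /e /e'; case/orP: ll => /eqP ->; case: (odd k).
have [E _] := fires_altw cox k (rep w' f) ij.
rewrite wE (repM cox) (repE cox) E.
rewrite addr_ge0 // mulr_ge0 //; try by apply: pos_w'; rewrite !inE; case: (odd k); rewrite eqxx ?orbT.
  by apply: cheb_cartan_ge0.
by apply: cheb_cartan_ge0 => // N /kn /ltnW.
Qed.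

(** Were the coordinate zero, subtracting from a large constant vector the preimage [f] of a unit
    vector would give a nonnegative vector whose image is negative at [i], against [rep_ge0]. *)
Lemma rep_ones_neq0 w i : rep w (fun=> 1) i != 0.
Proof.
wlog wi : w / (len w <= len (s i * w)%g)%N.
  move=> H; have [/H //|lt] := leqP (len w) (len (s i * w)%g).
  have := H (s i * w)%g; rewrite (genKl cox) (repM cox) (rep_gen cox) fire_id oppr_eq0.
  by apply; exact: ltnW.
apply/eqP => w0; pose f := rep w^-1%g (fun k => (k == i)%:R).
have fi : rep w f i = 1 by rewrite -(repM cox) mulgV (rep1 cox) eqxx.
pose C := \sum_k `|f k|.
have fC k : `|f k| <= C by rewrite /C (bigD1 k) //= lerDl sumr_ge0.
have H k : 0 <= C * 1 + (-1) * f k.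
  by have := le_trans (ler_norm _) (fC k); lra.
have := rep_ge0 wi H.
by rewrite (rep_comb s m) w0 fi mulr0 add0r mulr1 oppr_ge0 ler10.
Qed.

(** The side of the [i]-th wall, tested on a point interior to the fundamental chamber. By
    [pos_len], it means that [i] is not a left descent of [w]. *)
Definition pos (w : W) (i : I) : bool := 0 < rep w (fun=> 1) i.

Lemma pos_genl w i : pos (s i * w)%g i = ~~ pos w i.
Proof.
rewrite /pos (repM cox) (rep_gen cox) fire_id oppr_gt0 -leNgt le_eqVlt.
by rewrite (negbTE (rep_ones_neq0 w i)).
Qed.

Lemma pos_len w i : pos w i = (len w <= len (s i * w)%g)%N.
Proof.
have H v : (len v <= len (s i * v)%g)%N -> pos v i.
  by move=> le; rewrite /pos lt_neqAle eq_sym rep_ones_neq0 rep_ge0.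
apply/idP/idP => [wi|/H //]; rewrite leqNgt; apply/negP => lt.
by have := H (s i * w)%g; rewrite (genKl cox) pos_genl wi => /(_ (ltnW lt)).
Qed.

Lemma len_pos w i : pos w i -> len (s i * w)%g = (len w).+1.
Proof.
move=> wi; have := pos_genl w i; rewrite wi pos_len (genKl cox) /= => /negbT.
by rewrite -ltnNge; have := len_genl i w; lia.
Qed.

Lemma len_npos w i : ~~ pos w i -> len w = (len (s i * w)%g).+1.
Proof. by rewrite -pos_genl => /len_pos; rewrite (genKl cox). Qed.

Lemma pos1 i : pos 1%g i.
Proof. by rewrite /pos (rep1 cox). Qed.

Lemma rep_pos w i f : pos w i -> (forall k, 0 <= f k) -> 0 <= rep w f i.
Proof. by rewrite pos_len => wi; exact: rep_ge0. Qed.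

Lemma rep_npos w i f : ~~ pos w i -> (forall k, 0 <= f k) -> rep w f i <= 0.
Proof.
rewrite -pos_genl => /rep_pos H /H.
by rewrite (repM cox) (rep_gen cox) fire_id oppr_ge0.
Qed.

Lemma all_pos w : (forall i, pos w i) -> w = 1%g.
Proof.
move=> wp; apply: contrapT => /len_descent[i].
by rewrite (len_pos (wp i)); lia.
Qed.

Let delta (k : I) : I -> R := fun l => (l == k)%:R.

(** On nonnegative vectors with zero [j]-th coordinate, the form [rep v _ i] is [>= 0] by the sign
    at [v] and [<= 0] by the sign at [v * s j], since [fire j] fixes them. It thus vanishes on that
    hyperplane. *)
Lemma rep_edge v i j f : pos v i -> ~~ pos (v * s j)%g i ->
  rep v f i = rep v (delta j) i * f j.
Proof.
move=> vi vji.
have Z g : (forall k, 0 <= g k) -> g j = 0 -> rep v g i = 0.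
  move=> g0 gj; apply/eqP; rewrite eq_le (rep_pos vi g0) andbT.
  have := rep_npos vji g0; rewrite (repM cox) (rep_gen cox).
  suff -> : fire m j g = g by [].
  by apply/funext => k; rewrite /fire gj mulr0 addr0.
pose g1 k := if k == j then 0 else Num.max (f k) 0.
pose g2 k := if k == j then 0 else Num.max (- f k) 0.
have Z1 : rep v g1 i = 0.
  by apply: Z; rewrite /g1 ?eqxx // => k; case: ifP => // _; rewrite le_max lexx orbT.
have Z2 : rep v g2 i = 0.
  by apply: Z; rewrite /g2 ?eqxx // => k; case: ifP => // _; rewrite le_max lexx orbT.
have -> : f = fun k => f j * delta j k + 1 * (1 * g1 k + (-1) * g2 k).
  apply/funext => k; rewrite /g1 /g2 /delta; case: eqVneq => [->|_]; first by rewrite mulr1 !mulr0 addr0 mulr0 addr0.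
  by rewrite mulr0 add0r; case: (ltP (f k) 0) => fk; case: ltP => fk'; lra.
rewrite !(rep_comb s m) Z1 Z2 /delta eqxx /= /g1 /g2 eqxx; ring.
Qed.

Lemma pos_edge_pos v i j : pos v i -> ~~ pos (v * s j)%g i ->
  (v * s j = s i * v)%g /\ forall w, pos (v * w)%g i = pos w j.
Proof.
move=> vi vji; have E f := rep_edge f vi vji.
set c := rep v (delta j) i in E.
have c0 : 0 < c by have := vi; rewrite /pos E mulr1.
split; last by move=> w; rewrite /pos (repM cox) E pmulr_rgt0.
(* This element has no left descent: it keeps the [k]-th coordinate of [delta k] equal to [1]. *)
suff : (s i * v * s j * v^-1)%g = 1%g.
  move=> /(congr1 (fun g => s i * (g * v)))%g.
  by rewrite mulgVK mul1g -!mulgA (genKl cox).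
apply: all_pos => k; apply: contrapT => /negP zk.
pose h := rep v^-1%g (delta k).
have hE : rep v h = delta k by rewrite -(repM cox) mulgV (rep1 cox).
have := rep_npos zk (f := delta k).
rewrite !(repM cox) -/h !(rep_gen cox) => /(_ _).
have d0 l : 0 <= delta k l by rewrite /delta ler0n.
move=> /(_ d0); case: (eqVneq k i) => [ki|ki].
  rewrite ki fire_id E fire_id mulrN opprK -E hE /delta ki eqxx.
  by rewrite ler10.
have hj : h j = 0.
  have : rep v h i = 0 by rewrite hE /delta eq_sym (negbTE ki).
  by rewrite E => /eqP; rewrite mulf_eq0 gt_eqF //= => /eqP.
have -> : fire m j h = h by apply/funext => l; rewrite /fire hj mulr0 addr0.
by rewrite hE /fire /delta eqxx eq_sym (negbTE ki) mulr0 addr0 ler10.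
Qed.

Lemma pos_edge v i j : pos v i != pos (v * s j)%g i ->
  (v * s j = s i * v)%g /\ forall w, pos (v * w)%g i = (pos v i == pos w j).
Proof.
case vi: (pos v i).
  case vji: (pos _ _) => // _; have [|E H] := @pos_edge_pos v i j vi; first by rewrite vji.
  by split=> // w; rewrite H; case: (pos w j).
case vji: (pos _ _) => // _.
have [|E H] := @pos_edge_pos (v * s j)%g i j vji; first by rewrite (genKr cox) vi.
split; first by rewrite -{2}[v](genKr cox j) E (genKl cox).
move=> w; have := H (s j * w)%g; rewrite mulgA (genKr cox) pos_genl => ->.
by case: (pos w j).
Qed.

End Length.

(** * Half-spaces of the Cayley graph *)

Section Halfspaces.
Context (R : realType) {W : groupType} {I : finType} (s : I -> W)
  (m : I -> I -> option nat).
Local Notation wprod := (wprod s).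
Local Notation len := (len s).
Local Notation pos := (@pos W I s R m).
Local Open Scope group_scope.

Definition dist (u v : W) : nat := len (u^-1 * v).

(* The pair [(g, i)] stands for the half-space of all [w] with [pos (g * w) i]. *)
Definition sep (g : W) (i : I) (u v : W) : bool := pos (g * u) i != pos (g * v) i.

Definition nearby (K : nat) (g : W) (i : I) (a : W) : Prop :=
  exists2 p, (dist a p <= K)%N & sep g i a p.

Definition btw (o u v : W) : Prop :=
  forall g i, pos (g * o) i -> pos (g * v) i -> pos (g * u) i.

Definition reflection (g : W) (i : I) : W := g^-1 * (s i * g).

Context (cox : coxeter_system s m).

Lemma distxx u : dist u u = 0%N.
Proof. by rewrite /dist mulVg (len1 cox). Qed.

Lemma dist0 u v : dist u v = 0%N -> u = v.
Proof. by move=> /(len0 cox) /(congr1 (fun g => u * g)); rewrite mulVKg mulg1. Qed.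

Lemma distC u v : dist u v = dist v u.
Proof. by rewrite /dist -(lenV cox) invgM invgK. Qed.

Lemma dist_triangle u v w : (dist u w <= dist u v + dist v w)%N.
Proof.
rewrite /dist; have -> : u^-1 * w = (u^-1 * v) * (v^-1 * w) by rewrite mulgA mulgK.
exact: (lenM cox).
Qed.

Lemma dist_mull g u v : dist (g * u) (g * v) = dist u v.
Proof. by rewrite /dist invgM -mulgA mulKg. Qed.

Lemma dist_gen u i : (dist u (u * s i) <= 1)%N.
Proof. by rewrite /dist mulKg; exact: (len_gen cox). Qed.

Lemma dist_wprod u l : (dist u (u * wprod l) <= size l)%N.
Proof. by rewrite /dist mulKg; exact: (len_wprod cox). Qed.

Lemma dist_word u v : exists2 l, v = u * wprod l & size l = dist u v.
Proof. by have [l lE ls] := len_word cox (u^-1 * v); exists l; rewrite // lE mulVKg. Qed.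

Lemma dist_pos u x j : pos (u^-1 * x) j -> dist (u * s j) x = (dist u x).+1.
Proof. by move=> p; rewrite /dist invgM (genV cox) -mulgA (len_pos cox p). Qed.

Lemma dist_npos u x j : ~~ pos (u^-1 * x) j -> dist u x = (dist (u * s j) x).+1.
Proof. by move=> p; rewrite /dist invgM (genV cox) -mulgA -(len_npos cox p). Qed.

Lemma sep_edge g i u j : sep g i u (u * s j) ->
  reflection g i * u = u * s j /\
  forall x, pos (g * x) i = (pos (g * u) i == pos (u^-1 * x) j).
Proof.
rewrite /sep mulgA => /(pos_edge cox)[E H]; split.
  by rewrite /reflection -!mulgA -E -mulgA mulKg.
by move=> x; rewrite -H -mulgA mulVKg.
Qed.

Lemma sep_word g i u l : sep g i u (u * wprod l) ->
  exists l1 j l2, l = l1 ++ j :: l2 /\ sep g i (u * wprod l1) (u * wprod l1 * s j).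
Proof.
elim: l u => [|j l IH] u /=; first by rewrite /sep mulg1 eqxx.
case suj: (sep g i u (u * s j)); first by exists [::], j, l; rewrite /= mulg1.
have -> : sep g i u (u * (s j * wprod l)) = sep g i (u * s j) (u * s j * wprod l).
  by move: suj; rewrite /sep => /negbFE/eqP ->; rewrite [u * (_ * _)]mulgA.
move=> /IH[l1 [k [l2 [-> H]]]]; exists (j :: l1), k, l2.
by rewrite /= mulgA.
Qed.

Lemma refl_pos g i a : pos (g * (reflection g i * a)) i = ~~ pos (g * a) i.
Proof. by rewrite /reflection !mulgA mulgV mul1g -mulgA (pos_genl cox). Qed.

(** Reflecting the part of a shortest path beyond the wall deletes the crossing letter: the exchange
    condition. *)
Lemma dist_refl g i o a : sep g i o a -> (dist o (reflection g i * a) < dist o a)%N.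
Proof.
have [l -> <-] := dist_word o a; move=> /sep_word[l1 [j [l2 [-> /sep_edge[E _]]]]].
have -> : reflection g i * (o * wprod (l1 ++ j :: l2)) = o * wprod (l1 ++ l2).
  rewrite !wprod_cat /= !mulgA -[_ * _ * wprod l1]mulgA E.
  by rewrite (genKr cox).
apply: leq_ltn_trans (dist_wprod _ _) _.
by rewrite !size_cat /= addnS.
Qed.

Lemma nearby_edge K g i a : nearby K g i a ->
  exists l j, (size l < K)%N /\ sep g i (a * wprod l) (a * wprod l * s j).
Proof.
move=> [p]; have [l -> <-] := dist_word a p => lK /sep_word[l1 [j [l2 [lE H]]]].
by exists l1, j; split=> //; move: lK; rewrite lE size_cat /=; lia.
Qed.

Lemma nearby_refl K g i a : nearby K g i a -> (dist a (reflection g i * a) <= 2 * K + 1)%N.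
Proof.
move=> /nearby_edge[l [j [lK /sep_edge[E _]]]].
have := dist_triangle a (a * wprod l) (reflection g i * a).
have := dist_triangle (a * wprod l) (reflection g i * (a * wprod l)) (reflection g i * a).
have := dist_wprod a l; have := dist_gen (a * wprod l) j.
rewrite dist_mull E [dist _ a]distC; lia.
Qed.

Lemma nearby_trans K K' g i a b : nearby K g i a -> (dist b a <= K')%N ->
  nearby (K' + K) g i b.
Proof.
move=> [p ap sap] ba; case sba: (sep g i b a); first by exists a; rewrite // (leq_trans ba) // leq_addr.
exists p; first exact: leq_trans (dist_triangle _ a _) (leq_add ba ap).
by move: sba sap; rewrite /sep => /negbFE/eqP ->.
Qed.

Lemma nearby_mono K K' g i a : (K <= K')%N -> nearby K g i a -> nearby K' g i a.
Proof. by move=> KK [p ap sap]; exists p => //; exact: leq_trans KK. Qed.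

Lemma word_tuple K (l : seq I) : (size l <= K)%N ->
  exists t : K.-tuple (option I), pmap id t = l.
Proof.
move=> lK; have H : size (map Some l ++ nseq (K - size l) None) == K.
  by rewrite size_cat size_map size_nseq subnKC.
exists (Tuple H); rewrite /= pmap_cat.
have -> : pmap id (nseq (K - size l) None) = [::] :> seq I by elim: (_ - _)%N.
by rewrite cats0; elim: l {lK H} => //= i l ->.
Qed.

(* The sides of [v] with respect to the half-spaces near [a] take finitely many
   values up to translation, so each of them is realized at bounded distance. *)
Lemma local_model K : exists N, forall a v, exists y, (dist a y <= N)%N /\
  forall g i, nearby K g i a -> pos (g * y) i = pos (g * v) i.
Proof.
pose sig v : {ffun K.-tuple (option I) * I -> bool} :=
  [ffun p : K.-tuple (option I) * I => pos ((wprod (pmap id p.1))^-1 * v) p.2].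
pose y t : W := xget 1 [set w | sig w = t].
exists (\max_t len (y t)) => a v; set t := sig (a^-1 * v).
have yt : sig (y t) = t.
  by rewrite /y; case: xgetP => [w _ ->//|/(_ (a^-1 * v))]; rewrite /= -/t.
exists (a * y t); split.
  by rewrite /dist mulKg; exact: (leq_bigmax (F := fun t => len (y t)) t).
move=> g i /nearby_edge[l [j [/ltnW/word_tuple[u uE] /sep_edge[_ H]]]].
rewrite (H (a * y t)) (H v) !invgM -!mulgA mulKg; congr (_ == _).
by have := congr1 (fun f : {ffun _ -> bool} => f (u, j)) yt; rewrite !ffunE /= uE.
Qed.

(** On the way from [o] to [u], each wall crossed separates [o] from [u], hence from [v], so both
    distances drop together. *)
Lemma btw_dist o u v : btw o u v -> dist o v = (dist o u + dist u v)%N.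
Proof.
have [n] := ubnP (dist o u); elim: n o => // n IH o /ltnSE oun ouv.
have [E|/eqP ou] := eqVneq (o^-1 * u) 1.
  have -> : u = o by apply/esym/dist0; rewrite /dist E (len1 cox).
  by rewrite distxx.
have [j jlt] := len_descent cox ou.
have ju : ~~ pos (o^-1 * u) j by rewrite (pos_len cox) -ltnNge.
have jv : ~~ pos (o^-1 * v) j.
  by apply: contra ju; apply: ouv; rewrite mulVg (pos1 cox).
rewrite (dist_npos ju) (dist_npos jv) (IH (o * s j)) //.
  by move: oun; rewrite (dist_npos ju).
move=> g i po' pv; case po: (pos (g * o) i); first exact: ouv.
have /sep_edge[_ H] : sep g i o (o * s j) by rewrite /sep po po'.
by rewrite H po (negbTE ju).
Qed.

(** If [y] is a local model of [b] near [a], then [b] is between [a] and [y], so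
    [dist a b <= dist a y]. *)
Lemma nearby_dist K : exists N, forall a b,
  (forall g i, sep g i a b -> nearby K g i a) -> (dist a b <= N)%N.
Proof.
have [N HN] := local_model K; exists N => a b ab.
have [y [ay yE]] := HN a b.
have /btw_dist E : btw a b y.
  move=> g i pa; case pb: (pos (g * b) i) => //.
  by rewrite yE ?pb //; apply: ab; rewrite /sep pa pb.
by move: ay; rewrite E; lia.
Qed.

(** [dist a v - dist o v] counts the walls between [o] and [a], positively if [v] is on the side of
    [o] and negatively otherwise. The hypothesis keeps [v'] with [v] at every positive wall, so its
    count is no smaller. *)
Lemma defect_mono o a v v' :
  (forall g i, pos (g * o) i = pos (g * v) i -> sep g i a v ->
    pos (g * v') i = pos (g * v) i) ->
  (dist a v + dist o v' <= dist a v' + dist o v)%N.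
Proof.
have [n] := ubnP (dist o a); elim: n o => // n IH o /ltnSE oan H.
have [E|/eqP oa] := eqVneq (o^-1 * a) 1.
  have -> : a = o by apply/esym/dist0; rewrite /dist E (len1 cox).
  by rewrite addnC.
have [j jlt] := len_descent cox oa.
have ja : ~~ pos (o^-1 * a) j by rewrite (pos_len cox) -ltnNge.
have := IH (o * s j); rewrite -ltnS -(dist_npos ja) ltnS oan => /(_ isT) IH'.
have {}IH : (dist a v + dist (o * s j) v' <= dist a v' + dist (o * s j) v)%N.
  apply: IH' => g i po' av; case po: (sep g i o (o * s j)); last first.
    by apply: H => //; rewrite -po'; move: po => /negbFE/eqP.
  have [_ E] := sep_edge po.
  by move: av; rewrite /sep -po' (E a) (E (o * s j)) mulKg (negbTE ja) -(mulg1 (s j)) (pos_genl cox) (pos1 cox) eqxx.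
case jv: (pos (o^-1 * v) j).
  have jv' : pos (o^-1 * v') j.
    by rewrite H ?jv ?mulVg ?(pos1 cox) // /sep jv (negbTE ja).
  by move: IH; rewrite (dist_pos jv) (dist_pos jv'); lia.
have := leq_trans (dist_triangle o (o * s j) v') (leq_add (dist_gen o j) (leqnn _)).
by move: IH; rewrite (dist_npos (negbT jv)); move: (dist (o * s j) v') (dist (o * s j) v) => d d'; lia.
Qed.

(* Folding [a] along a half-space that separates it from [o] and [v] decreases
   [dist o a + dist a v]; this takes boundedly many steps by [defect_mono]. *)
Lemma fold_to_interval M C : exists D, forall o v a,
  (forall g i, pos (g * o) i = pos (g * v) i -> sep g i a v -> nearby C g i a) ->
  (dist o a + dist a v <= dist o v + M)%N ->
  exists2 u, btw o u v & (dist a u <= D)%N.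
Proof.
elim: M C => [|M IH] C.
  exists 0%N => o v a _ aM; exists a; last by rewrite distxx.
  move=> g i po pv; apply: contraT => pa.
  have so : sep g i o a by rewrite /sep po (negbTE pa).
  have sv : sep g i v a by rewrite /sep pv (negbTE pa).
  have := dist_triangle o (reflection g i * a) v; have := dist_refl so; have := dist_refl sv.
  by move: aM; rewrite ![dist v _]distC; lia.
(* The reflected point is within [2 * C + 1] of [a]; a wall separating it from [v] separates it from
   [a] or is within [C] of [a]. *)
have [D HD] := IH (2 * C + 1 + C)%N; exists (2 * C + 1 + D)%N => o v a H aM.
have [ab|/existsNP[g /existsNP[i]]] := pselect (btw o a v).
  by exists a => //; rewrite distxx.
move=> /not_implyP[po] /not_implyP[pv] /negP pa.
have so : sep g i o a by rewrite /sep po (negbTE pa).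
have sv : sep g i v a by rewrite /sep pv (negbTE pa).
have nr : nearby C g i a by apply: H; rewrite ?po ?pv // /sep pv (negbTE pa).
have aa' := nearby_refl nr.
have [||u uB ud] := HD o v (reflection g i * a); last 1 first.
- exists u => //; have := dist_triangle a (reflection g i * a) u; lia.
- move=> g' i' po' sv'; case av: (sep g' i' a v).
    by apply: nearby_trans (H _ _ po' av) _; rewrite distC.
  have sa : sep g' i' (reflection g i * a) a.
    by move: av sv'; rewrite /sep => /negbFE/eqP ->.
  by exists a => //; rewrite distC (leq_trans aa') // leq_addr.
- have := dist_refl so; have := dist_refl sv.
  by move: aM; rewrite ![dist v _]distC; lia.
Qed.

(** By [defect_mono] with a local model [y] of [v] near [a], and the triangle inequality,
    [dist o a + dist a v] exceeds [dist o v] by at most [2 * dist a y]. *)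
Lemma interval_approx C : exists D, forall o v a,
  (forall g i, pos (g * o) i = pos (g * v) i -> sep g i a v -> nearby C g i a) ->
  exists2 u, btw o u v & (dist a u <= D)%N.
Proof.
have [N HN] := local_model C; have [D HD] := fold_to_interval (2 * N)%N C.
exists D => o v a H; apply: HD => //.
have [y [ay yE]] := HN a v.
have := @defect_mono o a v y (fun g i po sv => yE _ _ (H _ _ po sv)).
by have := dist_triangle o y a; rewrite [dist y a]distC; lia.
Qed.

End Halfspaces.

(** * The weak order *)

Section WeakOrder.
Context (R : realType) {W : groupType} {I : finType} (s : I -> W)
  (m : I -> I -> option nat).
Local Notation wprod := (wprod s).
Local Notation len := (len s).
Local Notation pos := (@pos W I s R m).
Local Notation sep := (@sep R W I s m).
Local Notation dist := (dist s).
Local Open Scope group_scope.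

(* The (right) weak order, as inclusion of inversion sets. *)
Definition wle (u w : W) : Prop := forall g i, pos g i -> pos (g * w) i -> pos (g * u) i.

Context (cox : coxeter_system s m).

Lemma wle_trans v u w : wle u v -> wle v w -> wle u w.
Proof. by move=> uv vw g i p /(vw _ _ p) /(uv _ _ p). Qed.

Lemma wle1 w : wle 1 w.
Proof. by move=> g i; rewrite mulg1. Qed.

Lemma wle_btw u w : wle u w <-> btw R s m 1 u w.
Proof. by split=> H g i; have := H g i; rewrite mulg1. Qed.

Lemma wle_len u w : wle u w -> len w = (len u + len (u^-1 * w))%N.
Proof. by move=> /wle_btw /(btw_dist cox); rewrite /dist invg1 !mul1g. Qed.

Lemma pos_gen_edge g i j : pos g i -> ~~ pos (g * s j) i ->
  forall x, pos (g * x) i = pos x j.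
Proof.
move=> gi gji x; have [|_ ->] := @pos_edge W I s R m cox g i j.
  by rewrite gi (negbTE gji).
by rewrite gi; case: (pos x j).
Qed.

Lemma pos_gen_edgeN g i j : ~~ pos g i -> pos (g * s j) i ->
  forall x, pos (g * x) i = ~~ pos x j.
Proof.
move=> gi gji x; have [|_ ->] := @pos_edge W I s R m cox g i j.
  by rewrite gji (negbTE gi).
by rewrite (negbTE gi); case: (pos x j).
Qed.

Lemma wle_npos u w i : ~~ pos u i -> wle u w -> ~~ pos w i.
Proof.
move=> ui uw; apply: contra ui => wi.
by have := uw 1 i; rewrite (pos1 cox) !mul1g; apply.
Qed.

(** With [wle_mullV], this cancels and restores a common left descent in inductions on length. *)
Lemma wle_mull i u w : ~~ pos u i -> wle u w -> wle (s i * u) (s i * w).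
Proof.
move=> ui uw g k gk; rewrite !mulgA => gw.
case gi: (pos (g * s i) k); first exact: uw.
rewrite -mulgA (pos_gen_edge gk (negbT gi)) (pos_genl cox).
exact: ui.
Qed.

Lemma wle_mullV i z w : ~~ pos w i -> wle z (s i * w) ->
  pos z i /\ wle (s i * z) w.
Proof.
move=> wi zw; have zi : pos z i.
  by have := zw 1 i; rewrite (pos1 cox) !mul1g (pos_genl cox) wi; exact.
split=> // g k gk gw; case gi: (pos (g * s i) k).
  rewrite mulgA; apply: zw => //.
  by rewrite -mulgA (genKl cox).
by move: gw; rewrite (pos_gen_edge gk (negbT gi)) (negbTE wi).
Qed.

(** The sign conditions make the alternating letters successive left descents: by the recurrence of
    [cheb], the condition at [l.+1] for [w] is the one at [l] for [s i * w] with [i] and [j]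
    swapped. *)
Lemma wle_altw i j k w (c := cartan m i j : R) (f := rep s m w (fun=> 1%R)) : i != j ->
  (forall l, (l < k)%N -> (f i * cheb c l.+1 + f j * cheb c l < 0)%R) ->
  [/\ wle (wprod (altw i j k)) w, (k <= len w)%N &
      ((0 < k)%N -> ~~ pos (wprod (altw i j k)) i)].
Proof.
rewrite {}/c {}/f; elim: k i j w => [|k IH] i j w ij H; first by split=> //; exact: wle1.
have ji : j != i by rewrite eq_sym.
have wi : ~~ pos w i.
  by have := H 0%N isT; rewrite /= mulr1 mulr0 addr0 /pos -leNgt => /ltW.
have [|zw zk _] := IH j i (s i * w) ji.
  move=> l lk; have := H l.+1 lk.
  rewrite (repM cox) (rep_gen cox) fire_id /fire chebSS (cartan_sym cox j i).
  by apply: le_lt_trans; rewrite le_eqVlt; apply/orP; left; apply/eqP; ring.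
have [zi szw] := wle_mullV wi zw.
split=> //=; first by rewrite (len_npos cox wi) ltnS.
by move=> _; rewrite (pos_genl cox) zi.
Qed.

(* The witness is the longest element of the finite subgroup generated by [s i]
   and [s j]. *)
Lemma rank2_join i j w0 : i != j -> ~~ pos w0 i -> ~~ pos w0 j ->
  exists r, [/\ ~~ pos r i, ~~ pos r j &
    forall w, ~~ pos w i -> ~~ pos w j -> wle r w].
Proof.
move=> ij w0i w0j.
have neg w k : ~~ pos w k -> (rep s m w (fun=> 1) k < 0 :> R)%R.
  by rewrite /pos -leNgt le_eqVlt (negbTE (rep_ones_neq0 cox w k)).
have comb i' j' w l : i' != j' -> ~~ pos w i' -> ~~ pos w j' ->
    (forall n, m i' j' = Some n -> (l < n)%N) ->
    (rep s m w (fun=> 1) i' * cheb (cartan m i' j') l.+1 +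
      rep s m w (fun=> 1) j' * cheb (cartan m i' j') l < 0 :> R)%R.
  move=> ij' /neg wi /neg wj ln; case: l ln => [|l] ln; first by rewrite /= mulr1 mulr0 addr0.
  rewrite -[ltRHS]addr0 ler_ltD //; last first.
    by rewrite pmulr_llt0 // (cheb_cartan_gt0 cox).
  by rewrite nmulr_rle0 // (cheb_cartan_ge0 cox).
(* If the order is infinite, alternating words of every length lie below [w0], which is absurd
   beyond [len w0]. *)
case mij: (m i j) => [n|]; last first.
  have [|_ +] := @wle_altw i j (len w0).+1 w0 ij; last by rewrite ltnn.
  by move=> l _; apply: comb => // n; rewrite mij.
have mji : m j i = Some n by have [_ [-> _ _] _] := cox.
have ji : j != i by rewrite eq_sym.
have n0 : (0 < n)%N by have := order_ge2 cox ij mij; lia.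
have H i' j' w : i' != j' -> ~~ pos w i' -> ~~ pos w j' -> m i' j' = Some n ->
    [/\ wle (wprod (altw i' j' n)) w, (n <= len w)%N &
        ((0 < n)%N -> ~~ pos (wprod (altw i' j' n)) i')].
  by move=> ij' wi wj m'; apply: wle_altw => // l ln; apply: comb => // N; rewrite m' => -[<-].
exists (wprod (altw i j n)); split.
- by have [_ _ ->] := H i j w0 ij w0i w0j mij.
- by rewrite (wprod_altw cox mij); have [_ _ ->] := H j i w0 ji w0j w0i mji.
- by move=> w wi wj; have [] := H i j w ij wi wj mij.
Qed.

(** A common left descent of [z] and [z'] is cancelled, translating [X]. Otherwise a descent of each
    has a rank-two join [r] below [X]: bound [z] and [r], then [z'] and [r]; the two bounds share
    the descents of [r]. *)
Lemma lower_bounds_directed (X : set W) x0 : X x0 -> forall z z',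
  (forall x, X x -> wle z x) -> (forall x, X x -> wle z' x) ->
  exists u, [/\ forall x, X x -> wle u x, wle z u & wle z' u].
Proof.
have [n] := ubnP (len x0); elim: n X x0 => // n IH X x0 /ltnSE x0n Xx0.
have common i z z' : ~~ pos z i -> ~~ pos z' i ->
    (forall x, X x -> wle z x) -> (forall x, X x -> wle z' x) ->
    exists u, [/\ forall x, X x -> wle u x, wle z u & wle z' u].
  move=> zi z'i zX z'X.
  have Xi x : X x -> ~~ pos x i by move=> /zX; exact: wle_npos.
  pose Y : set W := [set s i * x | x in X].
  have lt : (len (s i * x0) < n)%N by rewrite -ltnS -(len_npos cox (Xi _ Xx0)).
  have Yx0 : Y (s i * x0) by exists x0.
  have [||u [uY zu z'u]] := IH Y (s i * x0) lt Yx0 (s i * z) (s i * z').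
  - by move=> _ [x Xx <-]; exact/wle_mull/zX.
  - by move=> _ [x Xx <-]; exact/wle_mull/z'X.
  have uX x : X x -> pos u i /\ wle (s i * u) x.
    by move=> Xx; apply: wle_mullV; [exact: Xi | apply: uY; exists x].
  have [ui _] := uX _ Xx0.
  have sui : ~~ pos (s i * u) i by rewrite (pos_genl cox) ui.
  exists (s i * u); split; first by move=> x /uX[].
    by have [] := @wle_mullV i (s i * z) (s i * u) sui; rewrite ?(genKl cox).
  by have [] := @wle_mullV i (s i * z') (s i * u) sui; rewrite ?(genKl cox).
move=> z z' zX z'X.
have [->|/eqP z1] := eqVneq z 1; first by exists z'; split=> //; exact: wle1.
have [->|/eqP z'1] := eqVneq z' 1; first by exists z; split=> //; exact: wle1.
have [i ilt] := len_descent cox z1; have [j jlt] := len_descent cox z'1.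
have zi : ~~ pos z i by rewrite (pos_len cox) -ltnNge.
have z'j : ~~ pos z' j by rewrite (pos_len cox) -ltnNge.
have [ij|ij] := eqVneq i j; first by apply: (common i) => //; rewrite ij.
have [r [ri rj rle]] := rank2_join ij (wle_npos zi (zX _ Xx0)) (wle_npos z'j (z'X _ Xx0)).
have rX x : X x -> wle r x.
  by move=> Xx; apply: rle; [exact: wle_npos zi (zX _ Xx) | exact: wle_npos z'j (z'X _ Xx)].
have [u1 [u1X zu1 ru1]] := common i z r zi ri zX rX.
have [u2 [u2X z'u2 ru2]] := common j z' r z'j rj z'X rX.
have [u [uX u1u u2u]] := common i u1 u2 (wle_npos ri ru1) (wle_npos ri ru2) u1X u2X.
exists u; split=> //; first exact: wle_trans zu1 u1u.
exact: wle_trans z'u2 u2u.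
Qed.

(** [J] is a longest element below all upper bounds of [A]. By directedness some such element is
    above both [J] and a given [a], and by length it equals [J]. *)
Lemma join_exists (A : set W) v : (forall a, A a -> wle a v) ->
  exists J, (forall a, A a -> wle a J) /\
            forall w, (forall a, A a -> wle a w) -> wle J w.
Proof.
move=> Av; pose X : set W := [set w | forall a, A a -> wle a w].
pose P k := `[< exists2 z, (forall x, X x -> wle z x) & len z = k >].
have P0 : exists k, P k.
  by exists 0%N; apply/asboolP; exists 1; [move=> x _; exact: wle1 | exact: (len1 cox)].
have Pv k : P k -> (k <= len v)%N.
  by move=> /asboolP[z zX <-]; rewrite (wle_len (zX v Av)) leq_addr.
case: (ex_maxnP P0 Pv) => k /asboolP[J JX Jk] kmax.
exists J; split=> // a Aa.
have [|u [uX Ju au]] := @lower_bounds_directed X v Av J a JX.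
  by move=> x; exact.
have : (len u <= k)%N by apply: kmax; apply/asboolP; exists u.
rewrite (wle_len Ju) Jk => le.
have -> : J = u by apply: (dist0 cox); rewrite /dist; lia.
exact: au.
Qed.

End WeakOrder.

(** * The Helly property of half-spaces *)

Section Helly.
Context {R : realType} {W : groupType} {I : finType} {s : I -> W}
  {m : I -> I -> option nat} (cox : coxeter_system s m).
Local Notation wprod := (wprod s).
Local Notation len := (len s).
Local Notation rep := (@rep R W I s m).
Local Notation pos := (@pos W I s R m).
Local Notation sep := (@sep R W I s m).
Local Notation nearby := (@nearby R W I s m).
Local Notation wle := (@wle R W I s m).
Local Notation dist := (dist s).

Definition tits_cone (z : I -> R) : Prop :=
  exists u h, (forall k, 0 <= h k) /\ z = rep u h.

(* The last point [f'] of the segment from [f] to [f + rep w g] in the fundamental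
   chamber lies on a wall [k = i]; reflecting in that wall fixes [f'] and
   shortens [w]. *)
Lemma tits_cone_add1 w f g : (forall k, 0 <= f k) -> (forall k, 0 <= g k) ->
  tits_cone (fun k => f k + rep w g k).
Proof.
have [n] := ubnP (len w); elim: n w f g => // n IH w f g /ltnSE wn f0 g0.
have [z0|] := pselect (forall k, 0 <= f k + rep w g k).
  by exists 1%g, (fun k => f k + rep w g k); split=> //; rewrite (rep1 cox).
move=> /existsNP[i0 /negP]; rewrite -ltNge => zi0.
case: (@arg_minP _ _ _ i0 (fun k => f k + rep w g k < 0) (fun k => f k / - rep w g k) zi0).
move=> i zi imin; set y := rep w g in zi0 zi imin *.
have yneg k : f k + y k < 0 -> 0 < - y k by have := f0 k; lra.
pose t := f i / - y i.
have t0 : 0 <= t by rewrite divr_ge0 ?f0 // ltW // yneg.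
have t1 : t < 1 by rewrite ltr_pdivrMr ?yneg // mul1r; lra.
pose f' k := f k + t * y k.
have f'0 k : 0 <= f' k.
  rewrite /f'; have fk := f0 k; have [yk|yk] := leP 0 (y k).
    by rewrite addr_ge0 // mulr_ge0.
  have [zk|zk] := leP 0 (f k + y k); first by nra.
  have := imin _ zk; rewrite ler_pdivlMr ?yneg // /t; lra.
have f'i : f' i = 0.
  by rewrite /f' /t invrN mulrN mulNr divfK ?subrr // lt_eqF // -oppr_gt0 yneg.
have wi : ~~ pos w i.
  by apply/negP => wi; have := rep_pos cox wi g0; have := f0 i; rewrite -/y; lra.
have [] := IH (s i * w)%g f' (fun k => (1 - t) * g k + 0 * g k).
- by move: wn; rewrite (len_npos cox wi).
- exact: f'0.
- by move=> k; rewrite mul0r addr0 mulr_ge0 ?subr_ge0 // ltW.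
move=> u [h [h0 E]]; exists (s i * u)%g, h; split=> //.
rewrite (repM cox) -E (rep_gen cox); apply/funext => k; rewrite /fire f'i.
rewrite !(rep_comb s m) !(repM cox) !(rep_gen cox) -/y fire_id /f' /fire; ring.
Qed.

Lemma tits_cone_add z1 z2 : tits_cone z1 -> tits_cone z2 ->
  tits_cone (fun k => z1 k + z2 k).
Proof.
move=> [u [f [f0 ->]]] [w [g [g0 ->]]].
have [v [h [h0 E]]] := tits_cone_add1 (u^-1 * w)%g f0 g0.
exists (u * v)%g, h; split=> //; rewrite (repM cox) -E.
apply/funext => k; have := rep_comb s m u 1 1 f (rep (u^-1 * w)%g g) k.
rewrite -(repM cox) mulVKg !mul1r => <-.
by congr (rep u _ k); apply/funext => l; rewrite !mul1r.
Qed.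

Lemma tits_cone_sum (T : Type) (r : seq T) (c : T -> R) (w : T -> W) :
  (forall p, 0 <= c p) ->
  tits_cone (fun k => \sum_(p <- r) c p * rep (w p) (fun=> 1) k).
Proof.
move=> c0; elim: r => [|p r IH].
  exists 1%g, (fun=> 0); split=> //; rewrite (rep1 cox).
  by apply/funext => k; rewrite big_nil.
have -> : (fun k => \sum_(q <- p :: r) c q * rep (w q) (fun=> 1) k) =
    fun k => c p * rep (w p) (fun=> 1) k + \sum_(q <- r) c q * rep (w q) (fun=> 1) k.
  by apply/funext => k; rewrite big_cons.
apply: tits_cone_add IH; exists (w p), (fun=> c p * 1 + 0 * 1).
split; first by move=> _; rewrite mulr1 mul0r addr0.
by apply/funext => k; rewrite (rep_comb s m (w p) (c p) 0 (fun=> 1) (fun=> 1)) mul0r addr0.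
Qed.

Lemma rep_sum (T : Type) (r : seq T) (c : T -> R) (F : T -> I -> R) g i :
  rep g (fun k => \sum_(p <- r) c p * F p k) i = \sum_(p <- r) c p * rep g (F p) i.
Proof.
elim: r => [|p r IH].
  rewrite big_nil.
  have := rep_comb s m g (0 : R) 0 (fun=> 0) (fun=> 0) i; rewrite !mul0r !addr0 => {2}<-.
  by congr (rep g _ i); apply/funext => k; rewrite big_nil.
rewrite big_cons -IH -[X in _ + X]mul1r -rep_comb.
by congr (rep g _ i); apply/funext => k; rewrite big_cons mul1r.
Qed.

(* An affine dependency between the points [rep (w p) 1] splits them into two
   families with a common point in the Tits cone. *)
Lemma radon n (g : 'I_n -> W) (i : 'I_n -> I) (w : 'I_n -> W) :
  (#|I|.+1 < n)%N ->
  (forall p q, p != q -> pos (g q * w p)%g (i q)) ->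
  exists u, forall q, pos (g q * u)%g (i q).
Proof.
move=> In gw.
(* The column of ones turns a kernel vector into an affine dependency. *)
pose M : 'M[R]_(n, #|I|.+1) := \matrix_(p, k)
  if unlift ord0 k is Some l then rep (w p) (fun=> 1) (enum_val l) else 1.
have : kermx M != 0.
  rewrite kermx_eq0 /row_free; apply: contraTneq In => <-.
  by rewrite -leqNgt rank_leq_col.
case/rowV0Pn => c /sub_kermxP cM c0.
have cM0 k : \sum_p c 0 p * M p k = 0.
  by have := congr1 (fun A : 'rV_ _ => A 0 k) cM; rewrite !mxE.
have csum : \sum_p c 0 p = 0.
  rewrite -[RHS](cM0 ord0); apply: eq_bigr => p _.
  by rewrite mxE unlift_none mulr1.
have crep k : \sum_p c 0 p * rep (w p) (fun=> 1) k = 0.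
  rewrite -[RHS](cM0 (lift ord0 (enum_rank k))); apply: eq_bigr => p _.
  by rewrite mxE liftK enum_rankK.
pose a p := Num.max (c 0 p) 0; pose b p := Num.max (- c 0 p) 0.
have a0 p : 0 <= a p by rewrite le_max lexx orbT.
have b0 p : 0 <= b p by rewrite le_max lexx orbT.
have ab p : c 0 p = a p - b p.
  by rewrite /a /b; case: (ltP (c 0 p) 0) => ?; case: ltP => ?; lra.
have zE : (fun k => \sum_p a p * rep (w p) (fun=> 1) k) =
          (fun k => \sum_p b p * rep (w p) (fun=> 1) k).
  apply/funext => k; apply: subr0_eq; rewrite -sumrB -[RHS](crep k).
  by apply: eq_bigr => p _; rewrite ab mulrBl.
have sE : \sum_p a p = \sum_p b p.
  by apply: subr0_eq; rewrite -sumrB -[RHS]csum; apply: eq_bigr => p _; rewrite ab.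
have [p0 cp0] : exists p, c 0 p != 0.
  apply: contrapT => H; move/eqP: c0; apply; apply/rowP => p; rewrite mxE.
  by apply: contrapT => /eqP cp; apply: H; exists p.
have pos_sum (d : 'I_n -> R) p : (forall p, 0 <= d p) -> 0 < d p -> 0 < \sum_p d p.
  by move=> d0 dp; rewrite (bigD1 p) //= ltr_pwDl // sumr_ge0.
have sum_pos (d : 'I_n -> R) : (forall p, 0 <= d p) -> 0 < \sum_p d p -> exists p, 0 < d p.
  move=> d0; apply: contraPP => /forallNP H; apply/negP; rewrite -leNgt sumr_le0 // => p _.
  by rewrite leNgt; apply/negP/H.
have a_pos : 0 < \sum_p a p.
  have [cp|cp] := ltP 0 (c 0 p0).
    by apply: (pos_sum _ p0) => //; rewrite lt_max cp.
  by rewrite sE; apply: (pos_sum _ p0) => //; rewrite lt_max oppr_gt0 lt_neqAle cp0 cp.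
have [u [h [h0 uh]]] := @tits_cone_sum _ (index_enum 'I_n) a w a0.
have key q (d : 'I_n -> R) : (forall p, 0 <= d p) -> d q = 0 -> 0 < \sum_p d p ->
    0 < rep (g q) (fun k => \sum_p d p * rep (w p) (fun=> 1) k) (i q).
  move=> d0 dq /(sum_pos _ d0)[p dp].
  have pq : p != q by apply: contraTneq dp => ->; rewrite dq ltxx.
  rewrite rep_sum; apply: (pos_sum _ p) => [p'|].
    have [->|p'q] := eqVneq p' q; first by rewrite dq mul0r.
    by rewrite mulr_ge0 // -(repM cox); exact/ltW/gw.
  by rewrite mulr_gt0 // -(repM cox); exact: gw.
(* One of [a q], [b q] is zero, so [key] puts the common point strictly inside half-space [q]. Were
   [u] outside, its closed chamber, which contains that point, would be weakly outside. *)
exists u => q; apply: contraT => gu.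
have : 0 < rep (g q) (fun k => \sum_p a p * rep (w p) (fun=> 1) k) (i q).
  have [cq|cq] := leP (c 0 q) 0; first by apply: key => //; exact/max_idPr.
  rewrite zE; apply: key => //; last by rewrite -sE.
  by apply/max_idPr; rewrite oppr_le0 ltW.
by rewrite uh -(repM cox) ltNge (rep_npos cox gu h0).
Qed.

(** If every deletion of one half-space left a common point, [radon] would give a point common to
    all; so some half-space can be deleted while more than [#|I|.+1] remain. *)
Lemma helly (L : seq (W * I)) :
  ~ (exists u, forall h, h \in L -> pos (h.1 * u)%g h.2) ->
  exists L', [/\ {subset L' <= L}, (size L' <= #|I|.+1)%N &
    ~ exists u, forall h, h \in L' -> pos (h.1 * u)%g h.2].
Proof.
have [n] := ubnP (size L); elim: n L => // n IH L /ltnSE Ln noL.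
have [small|big] := leqP (size L) #|I|.+1; first by exists L; split=> // h.
pose del p := take p L ++ drop p.+1 L.
have delL p : {subset del p <= L}.
  by move=> h; rewrite mem_cat => /orP[/mem_take|/mem_drop].
have [[p nop]|/forallNP all] := pselect (exists p : 'I_(size L),
    ~ exists u, forall h, h \in del p -> pos (h.1 * u)%g h.2).
  have [|L' [L'p sL' noL']] := IH (del p) _ nop.
    by rewrite (leq_trans _ Ln) // size_cat size_take size_drop ltn_ord; have := ltn_ord p; lia.
  by exists L'; split=> // h /L'p /delL.
exfalso; apply: noL.
have /choice[w wP] : forall p : 'I_(size L), exists u,
    forall h, h \in del p -> pos (h.1 * u)%g h.2.
  by move=> p; apply: contrapT; exact: all.
pose e (p : 'I_(size L)) := tnth (in_tuple L) p.
have [|u Hu] := @radon (size L) (fun p => (e p).1) (fun p => (e p).2) w big.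
  move=> p q pq; apply: wP; rewrite /e (tnth_nth (e q)) /= mem_cat.
  case: (ltngtP p q) => [lt|lt|/val_inj E]; last by rewrite E eqxx in pq.
    apply/orP; right; rewrite -(subnKC lt) -nth_drop mem_nth // size_drop.
    exact: ltn_sub2r (leq_ltn_trans lt (ltn_ord q)) (ltn_ord q).
  by apply/orP; left; rewrite -(nth_take _ lt) mem_nth // size_take ltn_ord.
exists u => h /(nthP h)[k kL <-]; have := Hu (Ordinal kL).
by rewrite /e (tnth_nth h).
Qed.

End Helly.

(** * Bounding the distance to a join *)

Section Join.
Context {R : realType} {W : groupType} {I : finType} {s : I -> W}
  {m : I -> I -> option nat} (cox : coxeter_system s m).
Local Notation len := (len s).
Local Notation pos := (@pos W I s R m).
Local Notation sep := (@sep R W I s m).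
Local Notation nearby := (@nearby R W I s m).
Local Notation wle := (@wle R W I s m).
Local Notation dist := (dist s).
Local Open Scope group_scope.

Lemma sep_compl g i u v : sep (s i * g) i u v = sep g i u v.
Proof. by rewrite /sep -!mulgA !(pos_genl cox); do 2 case: (pos _ _). Qed.

Lemma nearby_compl K g i a : nearby K (s i * g) i a -> nearby K g i a.
Proof. by move=> [p ap]; rewrite sep_compl; exists p. Qed.

(** Expresses [wle w u] by finitely many half-spaces, as [helly] requires: the wall of a left
    descent [i], and translates of those for [s i * w]. *)
Lemma inversions_finite w : exists L : seq (W * I),
  (forall h, h \in L -> ~~ pos h.1 h.2 /\ pos (h.1 * w) h.2) /\
  forall u, (forall h, h \in L -> pos (h.1 * u) h.2) -> wle w u.
Proof.
have [n] := ubnP (len w); elim: n w => // n IH w /ltnSE wn.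
have [->|/eqP w1] := eqVneq w 1; first by exists [::]; split=> // u _; exact: wle1.
have [i ilt] := len_descent cox w1.
have wi : ~~ pos w i by rewrite (pos_len cox) -ltnNge.
have [|L [Lw LP]] := IH (s i * w); first exact: leq_trans ilt wn.
exists ((s i, i) :: map (fun h => (h.1 * s i, h.2)) L); split.
  move=> h; rewrite inE => /orP[/eqP -> /=|/mapP[[g k] gL -> /=]].
    by rewrite (pos_genl cox) wi -[s i]mulg1 (pos_genl cox) (pos1 cox).
  have [/= gk gw] := Lw _ gL; split; last by rewrite -mulgA.
  apply/negP => gik; have := pos_gen_edgeN cox gk gik (s i * w).
  by rewrite gw (pos_genl cox) wi.
move=> u uP.
have ui : ~~ pos u i by have := uP (s i, i); rewrite inE eqxx /= (pos_genl cox); apply.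
have /(wle_mullV cox ui)[_] : wle (s i * w) (s i * u).
  apply: LP => -[g k] gL /=; have := uP (g * s i, k).
  rewrite inE mulgA; apply; apply/orP; right.
  by apply/mapP; exists (g, k).
by rewrite (genKl cox).
Qed.

Lemma count_ltn (T : eqType) (p q : pred T) (r : seq T) x :
  (forall y, y \in r -> p y -> q y) -> x \in r -> q x -> ~~ p x ->
  (count p r < count q r)%N.
Proof.
elim: r => // y r IH pq; rewrite inE => /orP[/eqP <-|xr] qx px /=.
  rewrite (negbTE px) qx add0n add1n ltnS.
  rewrite (@eq_in_count _ _ (predI p q)) => [|z zr /=].
    by apply: sub_count => z /andP[].
  by case pz: (p z) => //=; rewrite pq // inE zr orbT.
have {}IH : (count p r < count q r)%N.
  by apply: IH => // z zr; apply: pq; rewrite inE zr orbT.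
have := pq y (mem_head y r).
by case: (p y) => [/(_ isT) -> //|_]; rewrite add0n (leq_trans IH) // leq_addl.
Qed.

(* If [J] is the join of the family [A], a half-space containing [1] and [x] but not
   [J] is forced by at most [#|I|.+1] half-spaces bounding elements of [A], by
   [helly].  Those not containing [x] are near [x]; a nearby point realizing the
   sides of the near ones must be separated from [x] by a further one unless the
   given half-space is itself near, so this stops after [#|I|.+1] rounds. *)
Lemma join_dist C : exists D, forall (A : seq W) v J x,
  (forall a, a \in A -> wle a v) -> (forall a, a \in A -> wle a J) ->
  (forall w, (forall a, a \in A -> wle a w) -> wle J w) -> x \in A ->
  (forall a g i, a \in A -> pos g i -> pos (g * x) i -> ~~ pos (g * a) i -> nearby C g i x) ->
  (dist x J <= D)%N.
Proof.
have /choice[N NP] : forall K, exists N, forall a v, exists y, (dist a y <= N)%N /\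
    forall g i, nearby K g i a -> pos (g * y) i = pos (g * v) i := local_model R cox.
(* The maximum makes the radii nondecreasing, so half-spaces once near stay near. *)
pose kap K := maxn K (N K).
have kap_le K : (K <= kap K)%N by exact: leq_maxl.
have iter_le n K : (K <= iter n kap K)%N.
  by elim: n => //= n IH; exact: leq_trans IH (kap_le _).
have [D DP] := nearby_dist R cox (iter #|I|.+2 kap C).
exists D => A v J x Av AJ Jmin xA nearA; apply: (DP x J).
(* Up to complement the half-space contains [1]; as [x] is below [J], it then contains [x] and not
   [J]. *)
suff main g0 i0 : pos g0 i0 -> pos (g0 * x) i0 -> ~~ pos (g0 * J) i0 ->
    nearby (iter #|I|.+2 kap C) g0 i0 x.
  move=> g i gxJ; case gi: (pos g i).
    case gJ: (pos (g * J) i).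
      by move: gxJ; rewrite /sep gJ (AJ x xA _ _ gi gJ).
    by apply: main; rewrite ?gJ //; move: gxJ; rewrite /sep gJ; case: (pos _ _).
  have gi' : pos (s i * g) i by rewrite (pos_genl cox) gi.
  apply: nearby_compl; move: gxJ; rewrite -sep_compl => gxJ.
  case gJ: (pos (s i * g * J) i).
    by move: gxJ; rewrite /sep gJ (AJ x xA _ _ gi' gJ).
  by apply: main; rewrite ?gJ //; move: gxJ; rewrite /sep gJ; case: (pos _ _).
move=> g0i0 g0x g0J.
have /choice[inv invP] := inversions_finite.
pose L := flatten [seq inv a | a <- A].
have memL h : h \in L -> exists2 a, a \in A & h \in inv a.
  by move=> /flatten_mapP[a aA ha]; exists a.
have [|L' [L'L sL' noL']] := @helly R W I s m cox ((g0, i0) :: L).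
  move=> [u uP]; have /Jmin Ju : forall a, a \in A -> wle a u.
    move=> a aA; have [_] := invP a; apply=> h ha; apply: uP.
    by rewrite inE; apply/orP; right; apply/flatten_mapP; exists a.
  by have := uP (g0, i0) (mem_head _ _) => /(Ju _ _ g0i0); rewrite (negbTE g0J).
pose far K (h : W * I) := (h \in L) && ~~ `[< nearby K h.1 h.2 x >].
(* If [y] is on the side of [x], it misses some member of [L']. That member contains [v], so it was
   far; it also contains [x], so [y] shows that it is now near. *)
have progress K : (C <= K)%N -> nearby (kap K) g0 i0 x \/
    exists h, [/\ h \in L', far K h & ~~ far (kap K) h].
  move=> CK; have [y [xy yE]] := NP K x v.
  have xyK : (dist x y <= kap K)%N by apply: leq_trans xy _; exact: leq_maxr.
  case g0y: (sep g0 i0 x y); [by left; exists y | right].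
  have [[g i] hL' /= gy] : exists2 h, h \in L' & ~~ pos (h.1 * y) h.2.
    apply: contrapT => H; apply: noL'; exists y => h hL'.
    by apply: contrapT => hy; apply: H; exists h => //; exact/negP.
  have hL : (g, i) \in L.
    have := L'L _ hL'; rewrite inE => /orP[/eqP[gE iE]|//].
    by move: gy g0y; rewrite gE iE /sep g0x => /negbTE ->.
  have [a aA /(proj1 (invP a))[/= gi ga]] := memL _ hL.
  have gv : pos (g * v) i.
    apply: contraT => gv; have := Av a aA (s i * g) i.
    by rewrite -!mulgA !(pos_genl cox) gi gv ga => /(_ isT isT).
  have nfar : ~ nearby K g i x by move=> nr; move: gy; rewrite yE // gv.
  have gx : pos (g * x) i.
    apply: contraT => gx; exfalso; apply/nfar/(nearby_mono CK)/nearby_compl/(nearA a) => //;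
    by rewrite -?mulgA (pos_genl cox) ?gi ?gx ?ga.
  exists (g, i); split=> //; first by rewrite /far hL /=; exact/asboolPn.
  rewrite /far hL /= negbK; apply/asboolP; exists y => //.
  by rewrite /sep gx (negbTE gy).
have step n K : (C <= K)%N -> (count (far K) L' <= n)%N ->
    nearby (iter n.+1 kap K) g0 i0 x.
  elim: n K => [|n IH] K CK farn; have [nr|[h [hL' hK hK']]] := progress K CK.
  - exact: nr.
  - by move: farn; rewrite leqNgt -has_count => /hasPn/(_ _ hL'); rewrite hK.
  - by rewrite iterSr; apply: nearby_mono nr; exact: iter_le.
  rewrite iterSr; apply: IH; first exact: leq_trans CK (kap_le _).
  rewrite -ltnS; apply: leq_trans farn; apply: (count_ltn (x := h)) => //.
  move=> k _ /andP[kL /asboolPn kn]; rewrite /far kL /=; apply/asboolPn => kK; apply: kn.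
  exact: nearby_mono kK.
by apply: step => //; exact: leq_trans (count_size _ _) sL'.
Qed.

End Join.

(** * Geodesics tracking sequences with bounded bracketing *)

Section Tracking.
Context (R : realType) {W : groupType} {I : finType} (s : I -> W)
  (m : I -> I -> option nat).
Local Notation wprod := (wprod s).
Local Notation len := (len s).
Local Notation pos := (@pos W I s R m).
Local Notation sep := (@sep R W I s m).
Local Notation nearby := (@nearby R W I s m).
Local Notation wle := (@wle R W I s m).
Local Notation dist := (dist s).
Local Open Scope group_scope.

Lemma wprod_rcons l i : wprod (rcons l i) = wprod l * s i.
Proof. by rewrite -cats1 wprod_cat /= mulg1. Qed.

Definition bracketed (C n : nat) (b : nat -> W) : Prop :=
  forall j k l g i, (j <= k)%N -> (k <= l)%N -> (l <= n)%N ->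
    sep g i (b j) (b k) -> sep g i (b k) (b l) -> nearby C g i (b k).

Context (cox : coxeter_system s m).

Section Chain.
Context (a : nat -> W) (a0 : a 0%N = 1).
Context (bra : forall E, exists C, forall n b,
  (forall k, (k <= n)%N -> (dist (a k) (b k) <= E)%N) -> bracketed C n b).

Lemma finite_chain : exists E, forall n, exists y : nat -> W,
  (forall k, (k < n)%N -> (dist (a k) (y k) <= E)%N) /\
  (forall j k, (j <= k)%N -> (k < n)%N -> wle (y j) (y k)).
Proof.
have [C0 C0P] := bra 0%N.
have [D DP] := interval_approx R cox C0.
have [C1 C1P] := bra D; have [D1 D1P] := @join_dist R W I s m cox C1.
exists (D + D1)%N => n.
have daa k : (k <= n)%N -> (dist (a k) (a k) <= 0)%N by rewrite (distxx cox).
have bra_a := C0P n a daa.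
have /choice[u uP] : forall k, exists u, (k <= n)%N -> wle u (a n) /\ (dist (a k) u <= D)%N.
  move=> k; have [kn|_] := leqP k n; last by exists 1.
  have [|u ub ud] := DP 1 (a n) (a k); last by exists u => _; split=> //; apply/wle_btw.
  move=> g i g1 ga; apply: (bra_a 0%N k n) => //.
  by rewrite a0 /sep g1 eq_sym; move: ga; rewrite /sep.
pose A k := [seq u j | j <- iota 0 k.+1].
have Au k c : c \in A k -> exists2 j, (j <= k)%N & c = u j.
  by move=> /mapP[j]; rewrite mem_iota /= add0n ltnS => jk ->; exists j.
have uA j k : (j <= k)%N -> u j \in A k.
  by move=> jk; apply: map_f; rewrite mem_iota /= add0n ltnS.
have Aan k c : (k < n)%N -> c \in A k -> wle c (a n).
  by move=> kn /Au[j jk ->]; have [] := uP j (leq_trans jk (ltnW kn)).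
have /choice[y yP] : forall k, exists J, (k < n)%N ->
    (forall c, c \in A k -> wle c J) /\ forall w, (forall c, c \in A k -> wle c w) -> wle J w.
  move=> k; have [kn|_] := ltnP k n; last by exists 1.
  have [J [J1 J2]] := @join_exists R W I s m cox [set c | c \in A k] (a n) (fun c => Aan k c kn).
  by exists J => _; split.
exists y; split=> [k kn|j k jk kn].
  have [y1 y2] := yP k kn; have [_ ud] := uP k (ltnW kn).
  apply: leq_trans (dist_triangle cox _ (u k) _) _; apply: leq_add ud _.
  apply: (D1P (A k) (a n)) => //; [by move=> c; exact: Aan | exact: uA |].
  move=> c g i /Au[j jk ->] gi gk gj.
  (* The half-space contains [u k] but not [u j], hence not [a n], which is above [u j]. Ending [b]
     at [a n] makes this wall bracket [u k]. *)
  pose b l := if (l < n)%N then u l else a n.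
  have bE l : (l <= k)%N -> b l = u l by move=> lk; rewrite /b (leq_ltn_trans lk kn).
  have dab l : (l <= n)%N -> (dist (a l) (b l) <= D)%N.
    move=> ln; rewrite /b; case: ltnP => [ln'|nl]; first by have [] := uP l ln.
    by have -> : l = n by [apply/eqP; rewrite eqn_leq ln]; rewrite (distxx cox).
  rewrite -(bE k (leqnn k)); apply: (C1P n b dab j k n) => //.
  - exact: ltnW.
  - by rewrite /sep !bE // gk (negbTE gj).
  - have ga : ~~ pos (g * a n) i.
      by apply: contra gj; apply: (proj1 (uP j (leq_trans jk (ltnW kn)))).
    by rewrite /sep bE // /b ltnn gk (negbTE ga).
have [y1 y2] := yP j (leq_ltn_trans jk kn); have [z1 z2] := yP k kn.
by apply: y2 => c /Au[l lj ->]; apply/z1/uA/(leq_trans lj).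
Qed.

(** For [n > k], [Y n k] lies in a finite ball about [a k], so the ultrafilter selects one value;
    any finitely many selected values occur together at some [n]. *)
Lemma infinite_chain : exists E (y : nat -> W),
  (forall k, (dist (a k) (y k) <= E)%N) /\ (forall j k, (j <= k)%N -> wle (y j) (y k)).
Proof.
have [E /choice[Y YP]] := finite_chain; exists E.
have [F [FU Foo]] := ultraFilterLemma (eventually_filter : ProperFilter \oo).
have FP : ProperFilter F := ultra_proper.
have Fgt k : F [set n | (k < n)%N] by apply/Foo; exact: nbhs_infty_gt.
pose el k (t : E.-tuple (option I)) := a k * wprod (pmap id t).
have /choice[t tP] : forall k, exists t, F [set n | Y n k = el k t].
  move=> k; apply: contrapT => /forallNP none.
  have : F [set n | forall t, Y n k <> el k t].
    apply: filter_forall => t; have [|//] := in_ultra_setVsetC [set n | Y n k = el k t] FU.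
    by move=> /none.
  move=> none'; have [n [/= kn]] := filter_ex (filterI (Fgt k) none').
  have [/(_ k kn) + _] := YP n; have [l -> <-] := dist_word cox (a k) (Y n k).
  by move=> /word_tuple[t tl] /(_ t); rewrite /el tl.
exists (fun k => el k (t k)); split=> [k|j k jk].
  have [n [/= <- kn]] := filter_ex (filterI (tP k) (Fgt k)).
  by have [->] := YP n.
have [n [[/= <- <-] kn]] := filter_ex (filterI (filterI (tP j) (tP k)) (Fgt k)).
by have [_] := YP n; apply.
Qed.

End Chain.

Lemma geodesic_through (y : nat -> W) :
  (forall j k, (j <= k)%N -> wle (y j) (y k)) ->
  (forall n, exists k, (n <= len (y k))%N) ->
  exists b : nat -> W, [/\ forall n, cayley_adj s (b n) (b n.+1),
    forall n p, (n <= p)%N -> dist (b n) (b p) = (p - n)%N &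
    forall k, exists n, b n = y k].
Proof.
move=> yle /choice[K KP].
have /choice[red redP] : forall w, exists l, wprod l = w /\ size l = len w.
  by move=> w; have [l] := len_word cox w; exists l.
(* Lengths add along the weak order, so these concatenations of reduced words stay reduced, each
   extending the previous one. *)
pose fix ws k := if k is k'.+1 then ws k' ++ red ((y k')^-1 * y k) else red (y 0%N).
have wsE k : wprod (ws k) = y k /\ size (ws k) = len (y k).
  elim: k => [|k [IH1 IH2]] /=; first exact: redP.
  have [r1 r2] := redP ((y k)^-1 * y k.+1).
  by rewrite wprod_cat size_cat IH1 IH2 r1 r2 mulVKg (wle_len cox (yle k k.+1 (leqnSn k))).
have pre j k : (j <= k)%N -> exists t, ws k = ws j ++ t.
  move=> /subnKC <-; elim: (k - j)%N => [|d [t IH]]; first by exists [::]; rewrite addn0 cats0.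
  by rewrite addnS /= IH -catA; eexists.
pose b n := wprod (take n (ws (K n))).
have bE n k : (n <= len (y k))%N -> b n = wprod (take n (ws k)).
  move=> nk; rewrite /b; case: (leqP k (K n)) => [|/ltnW] /pre[t ->].
    by rewrite takel_cat // (proj2 (wsE k)).
  by rewrite takel_cat // (proj2 (wsE _)) KP.
exists b; split.
- move=> n; have lt := KP n.+1; rewrite (bE n (K n.+1)) ?(ltnW lt) // (bE n.+1 _ lt).
  move: lt; rewrite -(proj2 (wsE _)); move: (ws _) => l lt.
  case: l lt => // i0 l lt; exists (nth i0 (i0 :: l) n).
  by rewrite (take_nth i0) // wprod_rcons.
- move=> n p np; have kp := KP p; rewrite (bE p _ kp) (bE n _ (leq_trans np kp)).
  have [lw ls] := wsE (K p); move: lw ls kp; move: (ws _) => l lw ls kp.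
  set u := wprod (take n l); set v := wprod (take p l).
  have le : (dist u v <= p - n)%N.
    have -> : v = u * wprod (drop n (take p l)).
      by rewrite -wprod_cat -{1}(take_takel l np) cat_take_drop.
    apply: leq_trans (dist_wprod cox _ _) _.
    by rewrite size_drop size_take_min leq_sub2r // geq_minl.
  (* The three pieces have lengths at most those of their words, which sum to [len (y (K p))]; hence
     each bound is an equality. *)
  have := dist_triangle cox 1 u (y (K p)); have := dist_triangle cox u v (y (K p)).
  have d1 w : dist 1 w = len w by rewrite /dist invg1 mul1g.
  have := len_wprod cox (take n l); have := dist_wprod cox v (drop p l).
  rewrite -wprod_cat cat_take_drop lw !d1 size_drop ls -/u size_takel ?ls; last exact: leq_trans kp.
  move: (dist u v) (dist u (y (K p))) (dist v (y (K p))) (len u) (len (y (K p))) le kp np.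
  by clear; move=> d1 d2 d3 d4 d5; lia.
- move=> k; exists (len (y k)); rewrite (bE _ k (leqnn _)) -(proj2 (wsE k)) take_size.
  exact: (proj1 (wsE k)).
Qed.

Lemma cayley_dist_len u v : cayley_dist R s u v = (dist u v)%:R%R.
Proof.
have walk_dist n : cayley_walk s u v n -> (dist u v <= n)%N.
  move=> [p [<- <- adj]]; elim: n adj => [|n IH] adj; first by rewrite (distxx cox).
  apply: leq_trans (dist_triangle cox _ (p n) _) _.
  rewrite -[X in (_ <= X)%N]addn1; apply: leq_add.
    by apply: IH => k kn; apply/adj/leqW.
  by have [i ->] := adj n (ltnSn n); exact: (dist_gen cox).
have dist_walk : cayley_walk s u v (dist u v).
  have [l vE <-] := dist_word cox u v; exists (fun k => u * wprod (take k l)).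
  rewrite take0 take_size /= mulg1 vE; split=> // k.
  case: l {vE} => // i0 l kl; exists (nth i0 (i0 :: l) k).
  by rewrite (take_nth i0) // wprod_rcons mulgA.
rewrite /cayley_dist; apply/eqP; rewrite eq_le; apply/andP; split.
  apply: ge_inf; last by exists (dist u v).
  by exists 0%R => _ [n _ <-]; rewrite ler0n.
apply: lb_le_inf; first by exists (dist u v)%:R%R, (dist u v).
by move=> _ [n /walk_dist nd <-]; rewrite ler_nat.
Qed.

End Tracking.

(** * CAT(0) geometry *)

Section Convexity.
Context {R : realType}.

Let point (u v : R) : 'rV[R]_2 := \row_i (if i == 0 then u else v).

Let euclid_point u v u' v' :
  euclid_dist (point u v) (point u' v') = Num.sqrt ((u - u') ^+ 2 + (v - v') ^+ 2).
Proof. by rewrite /euclid_dist !big_ord_recl big_ord0 addr0 !mxE. Qed.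

Lemma comparison_triangle (a b c : R) : 0 <= a -> 0 <= b -> 0 <= c ->
  c <= a + b -> a <= b + c -> b <= a + c ->
  exists p q r : 'rV[R]_2,
    [/\ euclid_dist p q = a, euclid_dist p r = b & euclid_dist q r = c].
Proof.
move=> a0 b0 c0 cab abc bac.
have [aE|an0] := eqVneq a 0.
  have bc : b = c by move: abc cab bac; rewrite aE; lra.
  exists (point 0 0), (point 0 0), (point b 0).
  rewrite !euclid_point !subrr !sub0r expr0n /= !addr0 sqrtr0 sqrrN sqrtr_sqr ger0_norm //.
have {}a0 : 0 < a by rewrite lt_neqAle eq_sym an0.
(* Law of cosines: [u] is the abscissa of the third vertex. *)
pose u := (a ^+ 2 + b ^+ 2 - c ^+ 2) / (2 * a).
have uE : 2 * a * u = a ^+ 2 + b ^+ 2 - c ^+ 2 by rewrite /u mulrC divfK // mulf_neq0.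
have ub : u <= b by rewrite /u ler_pdivrMr ?mulr_gt0 //; nra.
have ub' : - b <= u by rewrite /u ler_pdivlMr ?mulr_gt0 //; nra.
have h0 : 0 <= b ^+ 2 - u ^+ 2 by nra.
exists (point 0 0), (point a 0), (point u (Num.sqrt (b ^+ 2 - u ^+ 2))).
rewrite !euclid_point !sub0r !sqrrN sqr_sqrtr // expr0n /= addr0; split.
- by rewrite sqrtr_sqr gtr0_norm.
- by rewrite addrC subrK sqrtr_sqr ger0_norm.
- have -> : (a - u) ^+ 2 + (b ^+ 2 - u ^+ 2) = c ^+ 2 by move: uE; nra.
  by rewrite sqrtr_sqr ger0_norm.
Qed.

Context {X : metricType R} (geo : @geodesic_space R X) (cat0 : @cat0_inequality R X).

(** Equal parameters cut off a homothetic comparison triangle of ratio [t]. *)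
Lemma cat0_contract (c1 c2 : R -> X) p q r t :
  geodesic_between c1 p q -> geodesic_between c2 p r -> 0 <= t <= 1 ->
  mdist (c1 (t * mdist p q)) (c2 (t * mdist p r)) <= t * mdist q r.
Proof.
move=> g1 g2 t01; have [c3 g3] := geo q r.
have [||||||p' [q' [r' [pq pr qr]]]] :=
  @comparison_triangle (mdist p q) (mdist p r) (mdist q r); rewrite ?mdist_ge0 //.
- by rewrite [mdist p q]metric_sym metric_triangle.
- by rewrite [mdist q r]metric_sym metric_triangle.
- by rewrite metric_triangle.
apply: le_trans (cat0 g1 g2 g3 pq pr qr t01 t01) _; rewrite -qr /euclid_dist.
have t0 : 0 <= t by case/andP: t01.
have -> : \sum_(i < 2) (((1 - t) *: p' + t *: q') 0 i - ((1 - t) *: p' + t *: r') 0 i) ^+ 2 =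
    t ^+ 2 * \sum_(i < 2) (q' 0 i - r' 0 i) ^+ 2.
  by rewrite mulr_sumr; apply: eq_bigr => i _; rewrite !mxE; ring.
by rewrite sqrtrM ?sqr_ge0 // sqrtr_sqr ger0_norm.
Qed.

Lemma geodesic_ray_sub (c : R -> X) a b : geodesic_ray c -> 0 <= a <= b ->
  geodesic_between (fun t => c (a + t)) (c a) (c b).
Proof.
move=> gc /andP[a0 ab].
have dab : mdist (c a) (c b) = b - a.
  by rewrite gc ?(le_trans a0 ab) // distrC ger0_norm // subr_ge0.
split; [by rewrite addr0 | by rewrite dab addrC subrK |].
move=> t u /andP[t0 _] /andP[u0 _]; rewrite gc ?addr_ge0 //.
by congr (`|_|); ring.
Qed.

Lemma geodesic_rev (c : R -> X) p q : geodesic_between c p q ->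
  geodesic_between (fun t => c (mdist p q - t)) q p.
Proof.
move=> [c0 c1 cd]; split.
- by rewrite subr0.
- by rewrite metric_sym subrr.
rewrite metric_sym => t u /andP[t0 t1] /andP[u0 u1].
rewrite cd ?subr_ge0 ?t1 ?u1 ?gerBl // distrC.
by congr (`|_|); ring.
Qed.

(* Comparing first the two geodesics from [c1 a], then the two geodesics to [c2 b]. *)
Lemma ray_convexity (c1 c2 : R -> X) a t b C : geodesic_ray c1 -> geodesic_ray c2 ->
  0 <= a <= t -> t <= b -> mdist (c1 a) (c2 a) <= C -> mdist (c1 b) (c2 b) <= C ->
  mdist (c1 t) (c2 t) <= C.
Proof.
move=> g1 g2 /andP[a0 at_] tb Ca Cb.
have [tE|ta] := eqVneq t a; first by rewrite tE.
have ab : a < b by apply: lt_le_trans tb; rewrite lt_neqAle eq_sym ta.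
have ab' : 0 <= a <= b by rewrite a0 ltW.
have len c : geodesic_ray c -> mdist (c a) (c b) = b - a.
  by move=> gc; rewrite gc ?(le_trans a0 (ltW ab)) // distrC ger0_norm // subr_ge0 ltW.
pose u := (t - a) / (b - a).
have ba0 : 0 < b - a by rewrite subr_gt0.
have u01 : 0 <= u <= 1.
  by rewrite divr_ge0 ?subr_ge0 ?(ltW ab) //= ler_pdivrMr // mul1r lerD2r.
have v01 : 0 <= 1 - u <= 1 by move: u01; lra.
have uE : u * (b - a) = t - a by rewrite divfK // gt_eqF.
have [d gd] := geo (c1 a) (c2 b).
have := cat0_contract (geodesic_ray_sub g1 ab') gd u01; rewrite len // uE.
have := cat0_contract (geodesic_rev gd) (geodesic_rev (geodesic_ray_sub g2 ab')) v01.
rewrite [mdist (c2 b) (c2 a)]metric_sym len // [mdist (c2 b) (c1 a)]metric_sym.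
have -> : b - a - (1 - u) * (b - a) = t - a by rewrite -uE; ring.
have -> : mdist (c1 a) (c2 b) - (1 - u) * mdist (c1 a) (c2 b) = u * mdist (c1 a) (c2 b) by ring.
rewrite ![a + (t - a)]addrC !subrK => H2 H1.
have := metric_triangle (c1 t) (d (u * mdist (c1 a) (c2 b))) (c2 t).
by move: u01 v01; nra.
Qed.

End Convexity.

Lemma compact_mdist_bounded (R : realType) (X : metricType R) (x : X) (A : set X) :
  compact A -> exists D, forall y, A y -> mdist x y <= D.
Proof.
move=> /compact_near_coveringP Aco.
have [N _ HN] : \forall n \near \oo, A `<=` [set y | mdist x y <= n%:R].
  apply: (Aco nat \oo (fun n y => mdist x y <= n%:R)) => y Ay.
  exists (ball y 1, [set n | ((Num.truncn (mdist x y)).+2 <= n)%N]) => /=.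
    by split; [exact: nbhsx_ballx | exact: nbhs_infty_ge].
  move=> [z n] /= []; rewrite ballEmdist /= => yz; rewrite -(ler_nat R) => /(le_trans _); apply.
  have := metric_triangle x y z; have := truncnS_gt (mdist x y).
  rewrite -[_.+2%:R]natr1; lra.
by exists N%:R => y; exact: (HN N (leqnn N)).
Qed.

(** * The orbit of [x] along a geodesic ray *)

Section Orbit.
Context {R : realType} {W : groupType} {I : finType} {s : I -> W}
  {m : I -> I -> option nat} {X : metricType R} {act : W -> X -> X} (x : X).
Context (cox : coxeter_system s m) (cat : cat0_space X) (geom : geometric_action act).
Local Notation len := (len s).
Local Notation dist := (dist s).

Let act1 y : act 1%g y = y.
Proof. by have [[->]] := geom. Qed.

Let actM g h y : act (g * h)%g y = act g (act h y).
Proof. by have [[_ ->]] := geom. Qed.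

Let iso g y z : mdist (act g y) (act g z) = mdist y z.
Proof. by have [_ _ _ ->] := geom. Qed.

Lemma orbit_lipschitz : exists c : R, 0 <= c /\
  forall u v, mdist (act u x) (act v x) <= c * (dist u v)%:R.
Proof.
exists (\sum_i mdist x (act (s i) x)); split; first by rewrite sumr_ge0 // => i _; exact: mdist_ge0.
move=> u v; have [l -> <-] := dist_word cox u v; rewrite actM iso.
elim: l => [|i l IH] /=; first by rewrite act1 mdistxx mulr0.
rewrite actM; apply: le_trans (metric_triangle _ (act (s i) x) _) _.
rewrite iso -natr1 mulrDr mulr1 addrC; apply: lerD IH _.
by rewrite (bigD1 i) //= lerDl sumr_ge0 // => j _; exact: mdist_ge0.
Qed.

Lemma orbit_proper (c : R) : exists N, forall u v,
  mdist (act u x) (act v x) <= c -> (dist u v <= N)%N.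
Proof.
have [c0|c0] := leP 0 c; last first.
  exists 0%N => u v /(le_trans (mdist_ge0 _ _)).
  by rewrite leNgt c0.
have [proper _ _ _] := cat; have [_ pd _ _] := geom.
have /pd/finite_seqP[r rE] := proper x c.
exists (\sum_(g <- r) len g)%N => u v uv.
have : (u^-1 * v)%g \in r.
  suff : [set` r] (u^-1 * v)%g by [].
  rewrite -rE /=; exists (act (u^-1 * v)%g x); split.
    by exists x => //=; rewrite mdistxx.
  by rewrite /= actM -(iso u) -actM mulgV act1.
by move=> ur; rewrite (big_rem _ ur) /= leq_addr.
Qed.

Lemma ray_act g (r : R -> X) : geodesic_ray r -> geodesic_ray (act g \o r).
Proof. by move=> gr t u t0 u0 /=; rewrite iso gr. Qed.

Lemma sep_consecutive (b : nat -> W) g i j k : (j <= k)%N ->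
  sep R s m g i (b j) (b k) ->
  exists l, [/\ (j <= l)%N, (l < k)%N & sep R s m g i (b l) (b l.+1)].
Proof.
move=> /subnKC <-; elim: (k - j)%N => [|n IH]; first by rewrite addn0 /sep eqxx.
rewrite addnS => bj; case bl: (sep R s m g i (b (j + n)%N) (b (j + n).+1)).
  by exists (j + n)%N; rewrite leq_addr.
have /IH[l [jl ln sl]] : sep R s m g i (b j) (b (j + n)%N).
  by move: bj bl; rewrite /sep => bj /negbFE/eqP ->.
by exists l; split=> //; exact: leqW.
Qed.

(* A half-space whose wall is crossed near [r l] and near [r l'] has a reflection of
   bounded displacement at [r l] and [r l'], hence, by convexity, in between. *)
Lemma ray_bracketed (r : R -> X) (D : R) : geodesic_ray r ->
  exists C, forall n b, (forall k, (k <= n)%N -> mdist (act (b k) x) (r k%:R) <= D) ->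
    bracketed R s m C n b.
Proof.
move=> gr; have [c [c0 cP]] := orbit_lipschitz.
have [N NP] := orbit_proper (D + 1 + D).
(* From [r l] to [e x], for a vertex [e] of a crossing edge; along that edge; and from its other end
   to the reflected [r l]. *)
pose C1 := (c * N%:R + D) + c + (c * N%:R + D).
have [C CP] := orbit_proper (D + C1 + D); exists C => n b bD.
have cross l g i : (l < n)%N -> sep R s m g i (b l) (b l.+1) ->
    mdist (r l%:R) (act (reflection s g i) (r l%:R)) <= C1.
  move=> ln sl; have bl := bD l (ltnW ln); have bl1 := bD l.+1 ln.
  have near_l : nearby R s m N g i (b l).
    exists (b l.+1) => //; apply: NP.
    apply: le_trans (metric_triangle _ (r l%:R) _) _; rewrite -addrA; apply: lerD bl _.
    apply: le_trans (metric_triangle _ (r l.+1%:R) _) _; apply: lerD.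
      by rewrite gr ?ler0n // -natr1 opprD addrA subrr sub0r normrN normr1.
    by rewrite metric_sym.
  have [w [j [wN /(sep_edge cox)[E _]]]] := nearby_edge cox near_l.
  set e := (b l * wprod s w)%g in E.
  have er : mdist (act e x) (r l%:R) <= c * N%:R + D.
    apply: le_trans (metric_triangle _ (act (b l) x) _) _; apply: lerD bl.
    apply: le_trans (cP _ _) _; apply: ler_wpM2l => //; rewrite ler_nat (distC cox) //.
    exact: leq_trans (dist_wprod cox _ _) (ltnW wN).
  apply: le_trans (metric_triangle _ (act (reflection s g i * e)%g x) _) _.
  apply: lerD; last by rewrite actM iso.
  apply: le_trans (metric_triangle _ (act e x) _) _.
  apply: lerD; first by rewrite metric_sym.
  apply: le_trans (cP _ _) _; rewrite -[leRHS]mulr1; apply: ler_wpM2l => //.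
  by rewrite E -[1]/(1%:R) ler_nat; exact: (dist_gen cox).
move=> j k l g i jk kl ln sjk skl.
have [p [jp pk sp]] := sep_consecutive jk sjk.
have [q [kq ql sq]] := sep_consecutive kl skl.
have kn := leq_trans kl ln.
have rk : mdist (r k%:R) (act (reflection s g i) (r k%:R)) <= C1.
  have [_ _ geo cat0] := cat.
  apply: (ray_convexity geo cat0 gr (ray_act (reflection s g i) gr) (a := p%:R) (b := q%:R)).
  - by rewrite ler0n ler_nat ltnW.
  - by rewrite ler_nat.
  - by apply: cross => //; exact: leq_trans pk kn.
  - by apply: cross => //; exact: leq_trans ql ln.
exists (reflection s g i * b k)%g; last by rewrite /sep refl_pos //; case: (pos _ _ _).
apply: CP; apply: le_trans (metric_triangle _ (act (reflection s g i) (r k%:R)) _) _.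
apply: lerD; last by rewrite actM iso metric_sym bD.
by apply: le_trans (metric_triangle _ (r k%:R) _) _; apply: lerD rk; exact: bD.
Qed.

Lemma orbit_cobounded : exists D, forall y, exists g, mdist (act g x) y <= D.
Proof.
have [_ _ [A cA AX] _] := geom.
have [D DP] := compact_mdist_bounded x cA; exists D => y.
have : (\bigcup_(g in setT) (act g @` A)) y by rewrite AX.
by move=> [g _ [z Az <-]]; exists g; rewrite iso DP.
Qed.

Lemma ray_chain (r : R -> X) : geodesic_ray r -> exists (D : R) (y : nat -> W),
  (forall k, mdist (act (y k) x) (r k%:R) <= D) /\
  (forall j k, (j <= k)%N -> wle R s m (y j) (y k)).
Proof.
move=> gr; have [c [c0 cP]] := orbit_lipschitz.
(* The chain must start at [1], so [D1] also allows for the distance from [x] to [r 0]. *)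
have [D0 D0P] := orbit_cobounded; pose D1 := Num.max D0 (mdist x (r 0)).
have /choice[a aP] : forall k : nat, exists g,
    mdist (act g x) (r k%:R) <= D1 /\ (k = 0%N -> g = 1%g).
  case=> [|k]; first by exists 1%g; rewrite act1 le_max lexx orbT.
  by have [g gP] := D0P (r k.+1%:R); exists g; rewrite le_max gP.
have near_a E k g : (dist (a k) g <= E)%N -> mdist (act g x) (r k%:R) <= c * E%:R + D1.
  move=> ag; apply: le_trans (metric_triangle _ (act (a k) x) _) _.
  apply: lerD (proj1 (aP k)); apply: le_trans (cP _ _) _.
  by apply: ler_wpM2l => //; rewrite ler_nat (distC cox).
have [|E [y [ay yle]]] := @infinite_chain R W I s m cox a (proj2 (aP 0%N) erefl).
  move=> E; have [C CP] := ray_bracketed (c * E%:R + D1) gr; exists C => n b bE.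
  by apply: CP => k kn; apply/near_a/bE.
by exists (c * E%:R + D1), y; split=> // k; exact/near_a/ay.
Qed.

Lemma ray_tracked (r : R -> X) : geodesic_ray r -> exists (K : R) (b : int -> W),
  geodesic_edge_path R s RayPath b /\
  forall t, 0 <= t -> exists2 z, Px_image act x RayPath b z & mdist (r t) z <= K.
Proof.
move=> gr; have [D [y [yD yle]]] := ray_chain gr.
have [c [c0 cP]] := orbit_lipschitz.
have unbounded n : exists k, (n <= len (y k))%N.
  (* If [len (y k) < n], the Lipschitz bound keeps [r k] within [M] of [r 0], which fails once
     [k > M]. *)
  pose M := mdist (r 0) x + c * n%:R + D.
  exists (Num.truncn M).+1; rewrite leqNgt; apply/negP => lt.
  have := truncnS_gt M; set k := (Num.truncn M).+1 in lt *.
  apply/negP; rewrite -leNgt.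
  have -> : k%:R = mdist (r 0) (r k%:R) by rewrite gr ?ler0n // sub0r normrN ger0_norm ?ler0n.
  apply: le_trans (metric_triangle _ (act (y k) x) _) _; apply: lerD (yD k).
  apply: le_trans (metric_triangle _ x _) _; rewrite lerD2l -{1}[x]act1.
  apply: le_trans (cP _ _) _; apply: ler_wpM2l => //.
  by rewrite ler_nat /dist invg1 mul1g ltnW.
have [b [badj bdist by_]] := geodesic_through cox yle unbounded.
(* The [1] pays for rounding [t] down to an integer. *)
exists (1 + D), (fun k : int => b `|k|%N); split; last first.
  move=> t t0; have /andP[kt tk] := truncn_itv t0; set k := Num.truncn t in kt tk.
  exists (act (y k) x).
    by left; have [n <-] := by_ k; exists n%:Z.
  apply: le_trans (metric_triangle _ (r k%:R) _) _; apply: lerD.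
    by rewrite gr ?ler0n // ger0_norm ?subr_ge0 // lerBlDl natr1 ltW.
  by rewrite metric_sym.
split.
  by case=> // n _ _; have := badj n; rewrite -PoszD addn1.
have distE n p : cayley_dist R s (b n) (b p) = `|n%:R - p%:R|.
  wlog np : n p / (n <= p)%N.
    move=> H; have [/H //|/ltnW/H E] := leqP n p.
    by rewrite distrC -E !(cayley_dist_len R cox) (distC cox).
  by rewrite (cayley_dist_len R cox) bdist // natrB // distrC ger0_norm // subr_ge0 ler_nat.
by case=> // n [] // p _ _; rewrite /= distE intrB.
Qed.

End Orbit.

Unset Implicit Arguments.

Theorem corollary6p3 (R : realType) (W : groupType) (I : finType) (s : I -> W)
    (m : I -> I -> option nat) (X : metricType R) (act : W -> X -> X) (x : X) :
  coxeter_system s m ->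
  cat0_space X ->
  geometric_action act ->
  (forall w : W, act w x = x -> w = 1%g) ->
  forall r : R -> X, geodesic_ray r ->
  exists (K : R) (D : path_domain) (b : int -> W),
    geodesic_edge_path R s D b /\
    forall t : R, 0 <= t -> exists2 z, Px_image act x D b z & mdist (r t) z <= K.
Proof.
move=> cox cat geom _ r gr.
by have [K [b H]] := ray_tracked x cox cat geom gr; exists K, RayPath, b.
Qed.
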